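(* There exists an absolute constant $c>0$ such that the following holds for every integer $n\ge 2$. Let $D$ be a projection body in $\mathbb{R}^n$ which is in isotropic position up to a dilation, and let $K$ be any origin-symmetric convex body in $\mathbb{R}^n$. Suppose that there exists $\xi\in S^{n-1}$ such that $P_K(\xi)>P_D(\xi)$. Then $$\max_{\xi\in S^{n-1}} \bigl(P_K(\xi)-P_D(\xi)\bigr) \ge \frac{c}{\log^2 n}\left(|K|^{\frac{n-1}{n}}-|D|^{\frac{n-1}{n}}\right).$$
   Context: A convex body in $\mathbb{R}^n$ is a compact convex set with nonempty interior; it is origin-symmetric if $K=-K$. $|\cdot|$ denotes volume of the proper dimension. For an origin-symmetric convex body $K$ in $\mathbb{R}^n$ and $\xi\in S^{n-1}$, $K\vert\xi^\perp$ is the orthogonal projection of $K$ onto the hyperplane $\xi^\perp$ through the origin perpendicular to $\xi$, and the projection function of $K$ is $P_K(\xi)=|K\vert\xi^\perp|$ (the $(n-1)$-dimensional volume). The support function of an origin-symmetric convex body $K$ is $h_K(x)=\max_{\xi\in K}(x,\xi)$, $x\in\mathbb{R}^n$. The projection body $\Pi K$ of an origin-symmetric convex body $K$ is the origin-symmetric convex body defined by $h_{\Pi K}(\theta)=|K\vert\theta^\perp|$ for all $\theta\in S^{n-1}$. A body $L$ is called a projection body if it is the projection body of some convex body. A body $K$ is in isotropic position if $|K|=1$ and there is a constant $L_K>0$ such that $\int_K (x,\xi)^2\,dx=L_K^2$ for all $\xi\in S^{n-1}$. A body $D$ is in isotropic position up to a dilation (is a dilate of an isotropic body) if $tD$ is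 in isotropic position for some $t>0$. ''Absolute constant'' means independent of $n$ and of the bodies. $\log^2 n=(\log n)^2$. *)

(* Defs.v *)
From HB Require Import structures.
From mathcomp Require Import all_boot all_order all_algebra.
From mathcomp Require Import all_classical all_reals all_analysis.
From mathcomp Require Import measurable_realfun ring.

Set Implicit Arguments.
Unset Strict Implicit.
Unset Printing Implicit Defensive.

Import Order.TTheory GRing.Theory Num.Theory.
Import numFieldTopology.Exports numFieldNormedType.Exports.

Local Open Scope classical_set_scope.
Local Open Scope ring_scope.

Definition measure_rV_display : measure_display.
Proof. exact: default_measure_display. Qed.

Section rV_measurable.
Variables (R : realType) (n : nat).

(* The product sigma-algebra of R^n: the one generated by the coordinates. *)
Definition rV_coord (i : 'I_n) (v : 'rV[R]_n) : measurableTypeR R := v ord0 i.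

Let rV_set0 : g_sigma_preimage rV_coord set0.
Proof. exact: sigma_algebra0. Qed.

Let rV_setC A : g_sigma_preimage rV_coord A -> g_sigma_preimage rV_coord (~` A).
Proof. exact: sigma_algebraC. Qed.

Let rV_bigcup (F : _^nat) : (forall i, g_sigma_preimage rV_coord (F i)) ->
  g_sigma_preimage rV_coord (\bigcup_i (F i)).
Proof. exact: sigma_algebra_bigcup. Qed.

HB.instance Definition _ := @isMeasurable.Build measure_rV_display
  'rV[R]_n (g_sigma_preimage rV_coord) rV_set0 rV_setC rV_bigcup.

End rV_measurable.

Definition rV_cons (R : realType) (n : nat)
    (p : measurableTypeR R * 'rV[R]_n) : 'rV[R]_n.+1 :=
  row_mx (p.1)%:M p.2.

(* Iterated product of the one-dimensional Lebesgue measure; lebesgue_rV_box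
   below gives its value on boxes, which determines it. *)
Fixpoint lebesgue_rV (R : realType) (n : nat) : set 'rV[R]_n -> \bar R :=
  match n with
  | 0 => \d_(0 : 'rV[R]_0)
  | m.+1 => pushforward (lebesgue_measure \x @lebesgue_rV R m)%E (@rV_cons R m)
  end.

Lemma measurable_fun_rV (R : realType) d (T : measurableType d) (n : nat)
    (f : T -> 'rV[R]_n) :
  (forall i, measurable_fun [set: T] (@rV_coord R n i \o f)) ->
  measurable_fun [set: T] f.
Proof.
move=> mf; have pre : g_sigma_preimage (fun i => @rV_coord R n i \o f)
    `<=` measurable.
  apply: smallest_sub; first exact: sigma_algebra_measurable.
  case: n => [|n] in f mf *; first by rewrite big_ord0.
  rewrite -bigcup_mkord_ord; apply: bigcup_sub => i Ii.
  by move=> A [B mB <-]; exact: mf.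
move=> _ A mA; rewrite setTI; apply: pre; rewrite g_sigma_preimage_comp.
by exists A => //; rewrite setTI.
Qed.

Lemma measurable_rV_coord (R : realType) (n : nat) (i : 'I_n) :
  measurable_fun [set: 'rV[R]_n] (@rV_coord R n i).
Proof.
move=> _ Y mY; rewrite setTI; apply: sub_sigma_algebra => /=.
rewrite -bigcup_seq/=; exists i => /=; first by rewrite mem_index_enum.
by exists Y => //; rewrite setTI.
Qed.

Lemma rV_cons0 (R : realType) (n : nat) (p : measurableTypeR R * 'rV[R]_n) :
  rV_cons p ord0 ord0 = p.1.
Proof.
have -> : (ord0 : 'I_n.+1) = lshift n (ord0 : 'I_1) by exact/val_inj.
by apply: etrans (row_mxEl _ _ _ _) _; rewrite mxE eqxx.
Qed.

Lemma rV_consS (R : realType) (n : nat) (p : measurableTypeR R * 'rV[R]_n)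
    (j : 'I_n) :
  rV_cons p ord0 (lift ord0 j) = p.2 ord0 j.
Proof.
have -> : lift ord0 j = rshift 1 j by exact/val_inj.
exact: row_mxEr.
Qed.

Lemma measurable_rV_cons (R : realType) (n : nat) :
  measurable_fun [set: measurableTypeR R * 'rV[R]_n] (@rV_cons R n).
Proof.
apply: measurable_fun_rV => i; have [j ->|->] := unliftP ord0 i.
- rewrite (_ : _ \o _ = @rV_coord R n j \o snd).
    apply: measurableT_comp; first exact: measurable_rV_coord.
    exact: measurable_snd.
  by apply/funext => p; rewrite /= /rV_coord rV_consS.
- rewrite (_ : _ \o _ = fst); first exact: measurable_fst.
  by apply/funext => p; rewrite /= /rV_coord rV_cons0.
Qed.

Definition rV_box (R : realType) (n : nat)
    (A : 'I_n -> set (measurableTypeR R)) : set 'rV[R]_n :=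
  [set v | forall i, A i (v ord0 i)].

Lemma measurable_rV_box (R : realType) (n : nat)
    (A : 'I_n -> set (measurableTypeR R)) :
  (forall i, measurable (A i)) -> measurable (rV_box A).
Proof.
move=> mA; rewrite (_ : rV_box A =
    \big[setI/setT]_(i < n) (@rV_coord R n i @^-1` A i)).
  apply: bigsetI_measurable => i _.
  by rewrite -[X in measurable X]setTI; exact: measurable_rV_coord.
rewrite -bigcap_seq; apply/seteqP; split => v /= vA i.
  by move=> _; exact: vA.
exact: (vA i (mem_index_enum i)).
Qed.

Lemma rV_cons_box (R : realType) (n : nat)
    (A : 'I_n.+1 -> set (measurableTypeR R)) :
  @rV_cons R n @^-1` rV_box A = A ord0 `*` rV_box (fun j => A (lift ord0 j)).
Proof.
apply/seteqP; split => p /=.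
  move=> pA; split => [|j]; first by have := pA ord0; rewrite rV_cons0.
  by have := pA (lift ord0 j); rewrite rV_consS.
move=> [p1 p2] i; have [j ->|->] := unliftP ord0 i.
  by rewrite rV_consS; exact: p2.
by rewrite rV_cons0.
Qed.

Section lebesgue_rV_measure.
Variable R : realType.
Local Open Scope ereal_scope.

Let mk_sigma_finite d (T : measurableType d) (m : set T -> \bar R) :
  m set0 = 0 -> (forall A, 0 <= m A) -> semi_sigma_additive m ->
  sigma_finite setT m ->
  exists mu : {sigma_finite_measure set T -> \bar R},
    m = mu :> (set T -> \bar R).
Proof.
move=> m0 m_ge0 m_add m_sf.
pose im := isMeasure.Build _ _ _ m m0 m_ge0 m_add.
pose M : {measure set T -> \bar R} := HB.pack_for {measure set T -> \bar R} m im.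
by exists (HB.pack_for {sigma_finite_measure set T -> \bar R} m im
  (Measure_isSigmaFinite.Build _ _ _ M m_sf)).
Qed.

Let spec (n : nat) := exists2 mu : {sigma_finite_measure set 'rV[R]_n -> \bar R},
  @lebesgue_rV R n = mu :> (set 'rV[R]_n -> \bar R) &
  forall A : 'I_n -> set (measurableTypeR R), (forall i, measurable (A i)) ->
    mu (rV_box A) = \prod_(i < n) lebesgue_measure (A i).

Let specP n : spec n.
Proof.
elim: n => [|n [mu muE mubox]].
  exists (\d_(0%R : 'rV[R]_0)) => // A _.
  rewrite big_ord0 /= diracE (_ : _ \in _ = true) //.
  by apply/mem_set => -[].
have box A : (forall i, measurable (A i)) ->
    @lebesgue_rV R n.+1 (rV_box A) = \prod_(i < n.+1) lebesgue_measure (A i).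
  move=> mA /=; rewrite /pushforward rV_cons_box muE product_measure1E//.
    by rewrite big_ord_recl; congr (_ * _); exact: mubox.
  exact: measurable_rV_box.
have mF := @measurable_rV_cons R n.
pose nu := pushforward (lebesgue_measure \x mu) (@rV_cons R n).
have nuE : @lebesgue_rV R n.+1 = nu by rewrite /nu/= muE.
pose F (k : nat) : set 'rV[R]_n.+1 := rV_box (fun _ => `[(- k%:R)%R, k%:R]%classic).
have mB k : measurable (F k) by apply: measurable_rV_box => i; exact: measurable_itv.
have nu_sf : sigma_finite setT nu.
  exists F => [|k].
    apply/esym/seteqP; split => // v _.
    have [M vM] : exists M : nat, (forall i, `|v ord0 i| <= M%:R)%R.
      exists (Num.bound (\sum_i `|v ord0 i|)%R) => i.
      rewrite (le_trans _ (ltW (archi_boundP _))) ?sumr_ge0//.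
      by rewrite (bigD1 i)//= lerDl sumr_ge0.
    by exists M => // i; rewrite /= in_itv/= -ler_norml; exact: vM.
  split=> //; rewrite -nuE box; last by move=> i; exact: measurable_itv.
  rewrite ltey_eq; apply/orP; left; elim/big_ind : _ => // [x y|i _]; first exact: fin_numM.
  by rewrite lebesgue_measure_itv; case: ifPn.
have nu_add : semi_sigma_additive nu.
  by unshelve apply: measure_semi_sigma_additive; exact: mF.
have [||nu' nuE'] := mk_sigma_finite _ _ nu_add nu_sf.
- by rewrite /nu /pushforward preimage_set0 measure0.
- by move=> A; exact: measure_ge0.
by exists nu' => [|A mA]; rewrite -nuE' -?nuE//; exact: box.
Qed.

Let lebesgue_rV_set0 n : @lebesgue_rV R n set0 = 0.
Proof. by have [mu -> _] := specP n; exact: measure0. Qed.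

Let lebesgue_rV_ge0 n A : 0 <= @lebesgue_rV R n A.
Proof. by have [mu -> _] := specP n; exact: measure_ge0. Qed.

Let lebesgue_rV_semi_sigma_additive n : semi_sigma_additive (@lebesgue_rV R n).
Proof. by have [mu -> _] := specP n; exact: measure_semi_sigma_additive. Qed.

HB.instance Definition _ n := isMeasure.Build _ _ _ (@lebesgue_rV R n)
  (lebesgue_rV_set0 n) (@lebesgue_rV_ge0 n) (@lebesgue_rV_semi_sigma_additive n).

Let lebesgue_rV_sigma_finite n : sigma_finite setT (@lebesgue_rV R n).
Proof. by have [mu -> _] := specP n; exact: sigma_finiteT. Qed.

HB.instance Definition _ n := Measure_isSigmaFinite.Build _ _ _
  (@lebesgue_rV R n) (@lebesgue_rV_sigma_finite n).

Lemma lebesgue_rV_box n (A : 'I_n -> set (measurableTypeR R)) :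
  (forall i, measurable (A i)) ->
  lebesgue_rV (rV_box A) = \prod_(i < n) lebesgue_measure (A i).
Proof. by have [mu -> h] := specP n; exact: h. Qed.

End lebesgue_rV_measure.

Lemma open_measurable_rV (R : realType) (n : nat) (U : set 'rV[R]_n) :
  open U -> measurable U.
Proof.
move=> oU.
pose B (p : nat * 'rV[rat]_n) : set 'rV[R]_n :=
  rV_box (fun j => ball (ratr (p.2 ord0 j) : R) p.1.+1%:R^-1).
have mB p : measurable (B p).
  by apply: measurable_rV_box => j; apply: open_measurable; exact: ball_open.
rewrite (_ : U = \bigcup_i (if unpickle i is Some p
    then if pselect (B p `<=` U) then B p else set0 else set0)).
  apply: bigcupT_measurable => i; case: unpickle => [p|]; last exact: measurable0.
  by case: (pselect _) => ?; [exact: mB|exact: measurable0].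
apply/seteqP; split => [x Ux|x [i _]]; last first.
  by case: unpickle => [p|//]; case: pselect => // BU /BU.
have /nbhs_ballP[e /= e0 eU] : nbhs x U by exact: open_nbhs_nbhs.
have [k ke] : exists k : nat, (k.+1%:R^-1 < e / 2 :> R).
  exists (Num.bound (e / 2)^-1).
  rewrite invf_plt ?posrE ?divr_gt0//.
  rewrite (lt_trans (archi_boundP _)) ?invr_ge0 ?divr_ge0 ?ltW//.
  by rewrite ltr_nat.
have k0 : 0 < k.+1%:R^-1 :> R by rewrite invr_gt0.
have qP j : exists q : rat, ball (ratr q : R) k.+1%:R^-1 (x ord0 j).
  have [||y [xy [q _ qy]]] := @dense_rat R (ball (x ord0 j) k.+1%:R^-1).
  - by exists (x ord0 j); exact: ballxx.
  - exact: ball_open.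
  - by exists q; apply: ball_sym; rewrite qy.
have [q xq] := choice qP.
pose p : nat * 'rV[rat]_n := (k, \row_j q j).
exists (pickle p) => //; rewrite pickleK; case: (pselect _) => [?|[]].
  by move=> j /=; rewrite mxE.
move=> y yB; apply: eU; split => // i j; rewrite (ord1 i).
have xB : ball (ratr (q j) : R) (e / 2) (x ord0 j).
  by apply: le_ball (ltW ke) _ _; exact: xq.
have {}yB : ball (ratr (q j) : R) (e / 2) (y ord0 j).
  by apply: le_ball (ltW ke) _ _; have := yB j; rewrite /= mxE.
exact: ball_splitr xB yB.
Qed.

Section euclidean.
Variables (R : realType) (n : nat).
Implicit Types (x y theta xi : 'rV[R]_n) (A K L P : set 'rV[R]_n).

Definition dotv x y : R := (x *m y^T) ord0 ord0.

(* The norm of 'rV[R]_n in the library is the sup norm, so the Euclidean unit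
   sphere is defined through the inner product. *)
Definition sphere : set 'rV[R]_n := [set xi | dotv xi xi = 1].

Definition volume A : R := fine (lebesgue_rV A).

Definition convex_body K := [/\ compact K, convex_set K & K° !=set0].

Definition sym_convex_body K := convex_body K /\ K = [set - x | x in K].

Definition hyperplane_projection K xi : set 'rV[R]_n :=
  [set x - dotv x xi *: xi | x in K].

Definition orthonormal_perp xi (B : 'M[R]_(n.-1, n)) :=
  B *m B^T = 1%:M /\ B *m xi^T = 0.

(* The rows of B are an orthonormal basis of the hyperplane orthogonal to xi,
   and y |-> y *m B is the resulting isometry from R^(n-1) onto it. *)
Definition perp_basis xi : 'M[R]_(n.-1, n) := get (orthonormal_perp xi).

Lemma perp_basisP xi : sphere xi -> orthonormal_perp xi (perp_basis xi).
Proof.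
move=> xi1; suff BP : exists B, orthonormal_perp xi B by exact: (getPex BP).
rewrite /sphere /dotv/= in xi1; rewrite /orthonormal_perp.
case: n xi xi1 => [xi|m xi xi1].
  by rewrite thinmx0 mul0mx mxE => /eqP; rewrite eq_sym oner_eq0.
suff [H [HH HT Hxi]] : exists H : 'M[R]_m.+1,
    [/\ H *m H = 1%:M, H^T = H & row ord0 H = xi].
  have HHE i j : \sum_k H i k * H j k = (i == j)%:R.
    have /matrixP/(_ i j) := HH; rewrite !mxE => <-.
    by apply: eq_bigr => k _; congr (_ * _); rewrite -[in LHS]HT mxE.
  exists (row' ord0 H); split; apply/matrixP => i j; rewrite !mxE.
    under eq_bigr do rewrite !mxE.
    by rewrite HHE (inj_eq (@lift_inj _ _)).
  rewrite (eq_bigr (fun k => H (lift ord0 i) k * H ord0 k)).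
    by rewrite HHE eq_sym (negPf (neq_lift _ _)).
  by move=> k _; rewrite -Hxi !mxE.
pose e : 'rV[R]_m.+1 := delta_mx ord0 ord0; pose w := xi - e.
have ee : e *m e^T = 1%:M.
  by rewrite trmx_delta mul_delta_mx; apply/matrixP => i j; rewrite !ord1 !mxE.
have xx : xi *m xi^T = 1%:M.
  by apply/matrixP => i j; rewrite !ord1 xi1 mxE.
have [->|w0] := eqVneq xi e.
  by exists 1%:M; rewrite mulmx1 trmx1 row1; split.
pose s := (w *m w^T) ord0 ord0.
have sE : w *m w^T = s%:M by rewrite [LHS]mx11_scalar.
have s0 : s != 0.
  apply: contra_neq w0; rewrite /s mxE => /eqP.
  rewrite psumr_eq0 => [/allP w0|i _]; last by rewrite [w^T _ _]mxE -expr2 sqr_ge0.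
  apply/eqP; rewrite -subr_eq0; apply/eqP/rowP => i; rewrite [RHS]mxE.
  have := w0 i (mem_index_enum i); rewrite [w^T _ _]mxE mulf_eq0 orbb => /eqP.
  by rewrite /w.
pose a := (e *m xi^T) ord0 ord0.
have aE : e *m xi^T = a%:M by rewrite [LHS]mx11_scalar.
have aE' : xi *m e^T = a%:M by rewrite -[LHS]trmxK trmx_mul trmxK aE tr_scalar_mx.
have sa : s = 2 * (1 - a).
  have := sE; rewrite /w linearB/= mulmxBl !mulmxBr ee xx aE aE'.
  move=> /matrixP/(_ ord0 ord0); rewrite !mxE/= !mulr1n => <-.
  ring.
have ew : (2 / s) *: (e *m w^T) = - 1%:M.
  rewrite /w linearB/= mulmxBr ee aE -raddfB/= scale_scalar_mx -raddfN/=.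
  congr (_%:M); have -> : a - 1 = - (s / 2) by rewrite sa; field.
  by field.
have xiE : xi = e + w by rewrite /w addrC subrK.
clearbody w; pose C := (2 / s) *: (w^T *m w).
have CC : C *m C = C + C.
  rewrite /C -scalemxAl -scalemxAr mulmxA -(mulmxA _ w) sE mul_mx_scalar.
  rewrite -scalemxAl !scalerA -scalerDl; congr (_ *: _); by field.
exists (1%:M - C); split.
- rewrite mulmxBl mul1mx mulmxBr mulmx1 CC opprB addrK.
  by rewrite subrK.
- by rewrite linearB/= linearZ/= trmx1 trmx_mul trmxK.
- rewrite rowE -/e mulmxBr mulmx1 -scalemxAr mulmxA scalemxAl ew mulNmx mul1mx.
  by rewrite opprK xiE.
Qed.

(* Volume of the projection of K in the coordinates of perp_basis xi; it does
   not depend on the chosen basis since Lebesgue measure is invariant under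
   orthogonal maps. *)
Definition projection_function K xi : R :=
  fine (lebesgue_rV
    [set y : 'rV[R]_n.-1 | hyperplane_projection K xi (y *m perp_basis xi)]).

(* The supremum is a maximum for K compact and nonempty. *)
Definition support_function K x : R := sup [set dotv x y | y in K].

Definition is_projection_body_of P L :=
  sym_convex_body P /\
  forall theta, sphere theta ->
    support_function P theta = projection_function L theta.

(* L is any convex body, not necessarily origin-symmetric. *)
Definition projection_body P :=
  exists2 L, convex_body L & is_projection_body_of P L.

Definition isotropic K :=
  lebesgue_rV K = 1%E /\
  exists2 c : R, 0 < c & forall xi, sphere xi ->
    (\int[@lebesgue_rV R n]_(x in K) (dotv x xi ^+ 2)%:E = (c ^+ 2)%:E)%E.

Definition dilate_of_isotropic K :=
  exists2 t : R, 0 < t & isotropic [set t *: x | x in K].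

End euclidean.

Definition is_max (R : realType) (S : set R) (m : R) := S m /\ ubound S m.

(* Main.v *)
Require Import Defs.
From mathcomp Require Import all_boot all_order all_algebra.
From mathcomp Require Import all_classical all_reals all_analysis.
From mathcomp Require Import measurable_realfun ring lra.

(** Write P_K for the projection function of K and M for the maximum of
    P_K - P_D.  If p is the minimum of P_D then P_K <= P_D + M <= (1 + M / p) P_D,
    and two facts about a projection body D of volume 1 finish the proof:
    Shephard's problem has a positive answer when the larger body is a
    projection body, so that |K|^((n-1)/n) <= 1 + M / p; and p is bounded below
    by an absolute constant when D is isotropic.  The general case follows by
    dilation.  The bound p >= 1/6 obtained below dominates c / log^2 n for
    c = log^2 2 / 6, because log n >= log 2.

    Both facts are proved by approximation with zonotopes, i.e. finite sums Z of
    segments [-u, u]: there is one that contains D and lies in a dilate of D by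
    a factor close to 1 (projection_body_zonotope).  Indeed Cauchy's formula (cauchy_polytope)
    exhibits the support function of the projection body of a polytope as that
    of a zonotope.  Its proof needs no facets: decompose the polytope
    P = { x | <x, nu_i> <= 1 } into the pyramids P_i on which nu_i is the
    largest functional.  Then P + [-t v, t v] lies in the union of the dilates
    (1 + t |<v, nu_i>|) P_i, which bounds the projection of P along v from
    above at first order in t; translating P by t v bounds it from below.

    The tool for zonotopes is that adding a segment [-u, u] to a convex body K
    adds exactly 2 |u| P_K(u / |u|) to its volume (seg_gain_sphere).  Adding
    the segments of a small multiple of Z one by one computes the volume of
    K + t Z at first order.  With K = Z this is the derivative of
    (1 + t)^n |Z| (sum_seg_gain_zonotope), and for general K the
    Brunn-Minkowski inequality gives Minkowski's first inequality
    (minkowski_zonotope); together they settle Shephard's problem.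

    For the lower bound on P_D, let L be the isotropic constant of D.  Slices of
    D orthogonal to xi have volume at most P_D(xi).  If P_D(xi) is small, then
    D cannot be concentrated near the hyperplane orthogonal to xi, and L is
    large (isotropic_shadow_ge).  Finally L <= 1: for X uniform in D
    and Q an orthogonal projection of rank k, isotropy says that the mean of
    <Q X, X> is k L^2, while X in Z bounds it by the mean of the sum of the
    |<Q u, X>| over the generators, hence by L times the sum of the |Q u|.  So
    the projections of the generators of Z have total length at least k L, and
    this property, which passes to the projections of Z, gives by induction on
    the dimension |Z| >= (2 L)^n (volume_zonotope_ge).  As Z is close to D, of
    volume 1, this bounds L. *)

Set Implicit Arguments.
Unset Strict Implicit.
Unset Printing Implicit Defensive.

Import Order.TTheory GRing.Theory Num.Theory.
Import numFieldTopology.Exports numFieldNormedType.Exports.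
Local Open Scope classical_set_scope.
Local Open Scope ring_scope.

(** * Lebesgue measure on row vectors: measurability and translations *)

Lemma measurable_mulmxD (R : realType) (m n : nat) (A : 'M[R]_(m, n))
    (b : 'rV[R]_n) :
  measurable_fun [set: 'rV[R]_m] (fun x : 'rV[R]_m => x *m A + b).
Proof.
apply: measurable_fun_rV => i.
rewrite (_ : _ \o _ =
    fun x => \sum_(j < m) rV_coord j x * A j i + b ord0 i); last first.
  by apply/funext => x; rewrite /= /rV_coord !mxE.
apply: measurable_funD; last exact: measurable_cst.
apply: measurable_sum => j; apply: measurable_funM; last exact: measurable_cst.
exact: measurable_rV_coord.
Qed.

Lemma measurable_mulmx (R : realType) (m n : nat) (A : 'M[R]_(m, n)) :
  measurable_fun [set: 'rV[R]_m] (fun x : 'rV[R]_m => x *m A).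
Proof.
rewrite (_ : (fun _ => _) = fun x => x *m A + 0); last first.
  by apply/funext => x; rewrite addr0.
exact: measurable_mulmxD.
Qed.

Lemma measurable_rV_addr (R : realType) (n : nat) (b : 'rV[R]_n) :
  measurable_fun [set: 'rV[R]_n] (fun x : 'rV[R]_n => x + b).
Proof.
rewrite (_ : (fun _ => _) = fun x => x *m 1%:M + b); last first.
  by apply/funext => x; rewrite mulmx1.
exact: measurable_mulmxD.
Qed.

Lemma measurable_rV_add_mulmx (R : realType) (m n : nat) (M : 'M[R]_(m, n)) :
  measurable_fun [set: 'rV[R]_n * 'rV[R]_m]
    (fun p : 'rV[R]_n * 'rV[R]_m => p.1 + p.2 *m M).
Proof.
apply: measurable_fun_rV => i.
rewrite (_ : _ \o _ = (rV_coord i \o fst) \+ (rV_coord i \o (mulmx^~ M \o snd))).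
  apply: measurable_funD.
    by apply: measurableT_comp; [exact: measurable_rV_coord|exact: measurable_fst].
  apply: measurableT_comp; first exact: measurable_rV_coord.
  by apply: measurableT_comp; [exact: measurable_mulmx|exact: measurable_snd].
by apply/funext => p; rewrite /= /rV_coord !mxE.
Qed.

Lemma measurable_preimage d1 d2 (T1 : measurableType d1)
    (T2 : measurableType d2) (f : T1 -> T2) (A : set T2) :
  measurable_fun setT f -> measurable A -> measurable (f @^-1` A).
Proof. by move=> mf mA; rewrite -[X in measurable X]setTI; exact: mf. Qed.

Lemma measurable_preimage_mulmx (R : realType) (m n : nat) (M : 'M[R]_(m, n))
    (A : set 'rV[R]_n) : measurable A -> measurable (mulmx^~ M @^-1` A).
Proof. by move=> mA; apply: measurable_preimage mA; exact: measurable_mulmx. Qed.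

Lemma pushforward_measureP d1 d2 (T1 : measurableType d1)
    (T2 : measurableType d2) (R : realType) (m : {measure set T1 -> \bar R})
    (f : T1 -> T2) : measurable_fun setT f ->
  exists mu : {measure set T2 -> \bar R}, forall A, mu A = m (f @^-1` A).
Proof.
by move=> mf; exists
  (measure_function_pushforward__canonical__measure_function_Measure m mf).
Qed.

Lemma lebesgue_measure_translate (R : realType) (a : R)
    (A : set (measurableTypeR R)) :
  measurable A -> lebesgue_measure ((fun x => x + a) @^-1` A) = lebesgue_measure A.
Proof.
move=> mA.
have mf : measurable_fun [set: measurableTypeR R]
    (fun x : measurableTypeR R => x + a : measurableTypeR R).
  by apply: measurable_funD; [exact: measurable_id|exact: measurable_cst].
have [mu muE] := pushforward_measureP lebesgue_measure mf.
rewrite -muE; apply/esym/lebesgue_measure_unique => // _ [[b c]] _ <-.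
rewrite muE /= (_ : _ @^-1` _ = `]b - a, c - a]%classic); last first.
  by apply/seteqP; split => x /=; rewrite !in_itv/= ltrBlDr lerBrDr.
rewrite !lebesgue_measure_itv/= !lte_fin ltrD2r.
by case: ifP => // _; rewrite -!EFinB; congr (_%:E); ring.
Qed.

Lemma lebesgue_rV_translate (R : realType) (n : nat) (v : 'rV[R]_n)
    (A : set 'rV[R]_n) :
  measurable A -> lebesgue_rV ((fun x => x + v) @^-1` A) = lebesgue_rV A.
Proof.
elim: n v A => [v A mA|n IH v A mA].
  congr (lebesgue_rV _); apply/seteqP.
  by split=> x /=; rewrite (_ : x + v = x)//; apply/rowP => -[].
pose f (p : measurableTypeR R * 'rV[R]_n) : measurableTypeR R * 'rV[R]_n :=
  (p.1 + v ord0 ord0, p.2 + \row_j v ord0 (lift ord0 j)).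
have mf : measurable_fun setT f.
  apply/measurable_fun_pair => /=.
    by apply: measurable_funD; [exact: measurable_fst|exact: measurable_cst].
  by apply: measurableT_comp (measurable_rV_addr _) _; exact: measurable_snd.
have fE p : rV_cons (f p) = rV_cons p + v.
  apply/rowP => j; have [i ->|->] := unliftP ord0 j.
    by rewrite [RHS]mxE !rV_consS !mxE.
  by rewrite [RHS]mxE !rV_cons0.
have mB : measurable (@rV_cons R n @^-1` A).
  by apply: measurable_preimage => //; exact: measurable_rV_cons.
have [mu muE] := pushforward_measureP
  (lebesgue_measure \x @lebesgue_rV R n)%E mf.
rewrite /= /pushforward.
rewrite [RHS](@product_measure_unique _ _ _ _ _ _ _ mu) => //.
  rewrite muE; congr ((_ \x _)%E _); apply/seteqP.
  by split => p; rewrite /preimage /mkset fE.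
move=> B C mB' mC; rewrite muE.
pose B' : set (measurableTypeR R) := (fun x => x + v ord0 ord0) @^-1` B.
pose C' : set 'rV[R]_n := (fun x => x + \row_j v ord0 (lift ord0 j)) @^-1` C.
have mB1 : measurable B'.
  by apply: measurable_preimage => //; apply: measurable_funD;
    [exact: measurable_id|exact: measurable_cst].
have mC1 : measurable C'.
  by apply: measurable_preimage => //; exact: measurable_rV_addr.
have h := product_measure1E lebesgue_measure (@lebesgue_rV R n) mB1 mC1.
transitivity (lebesgue_measure B' * lebesgue_rV C')%E; first exact: h.
by rewrite /B' /C' lebesgue_measure_translate// IH.
Qed.

(** * Linear images of Lebesgue measure *)

Lemma tonelli_sections d1 d2 (T1 : measurableType d1) (T2 : measurableType d2)
    (R : realType) (m1 : {sigma_finite_measure set T1 -> \bar R})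
    (m2 : {sigma_finite_measure set T2 -> \bar R}) (E : set (T1 * T2)) :
  measurable E ->
  (\int[m1]_x m2 (xsection E x) = \int[m2]_y m1 (ysection E y))%E.
Proof.
move=> mE; have [mu muE] : exists mu : {measure set (T1 * T2) -> \bar R},
    forall A, mu A = (m1 \x^ m2)%E A by exists (m1 \x^ m2)%E.
have h := @product_measure_unique _ _ _ _ R m1 m2 mu.
transitivity (mu E); last by rewrite muE.
by apply: h mE => A B mA mB; rewrite muE; exact: product_measure2E.
Qed.

Lemma integral_lebesgue_rV_indic (R : realType) (m : nat) (A : set 'rV[R]_m)
    (c : \bar R) (f : 'rV[R]_m -> \bar R) : measurable A -> (0 <= c)%E ->
    (forall x, A x -> f x = c) -> (forall x, ~ A x -> f x = 0%E) ->
  (\int[@lebesgue_rV R m]_x f x = lebesgue_rV A * c)%E.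
Proof.
move=> mA c0 fA f0; rewrite (eq_integral (fun x => (\1_A x)%:E * c)%E); last first.
  move=> x _; rewrite indicE; have [xA|xA] := boolP (x \in A).
    by rewrite mul1e fA//; exact: set_mem.
  by rewrite mul0e f0// => /mem_set; apply/negP.
rewrite ge0_integralZr ?integral_indic ?setIT//.
by apply/measurable_EFinP; exact: measurable_indic.
Qed.

(** Uniqueness of Haar measure in product form: both sides are the measure of
    the set of (x, y) with x in A and x + y M in B, sliced in x or in y, and
    translation invariance evaluates the slices.  Fixing A turns this into a
    computation of the measure of y |-> y M on every B from its value on one
    set. *)
Lemma lebesgue_rV_mulmx_swap (R : realType) (n : nat) (M N : 'M[R]_n)
    (A B : set 'rV[R]_n) : N *m M = 1%:M -> measurable A -> measurable B ->
  (lebesgue_rV A * lebesgue_rV (mulmx^~ M @^-1` B) =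
   lebesgue_rV B * lebesgue_rV (mulmx^~ M @^-1` (-%R @^-1` A)))%E.
Proof.
move=> NM mA mB.
have mNA : measurable (-%R @^-1` A : set 'rV[R]_n).
  rewrite (_ : -%R = mulmx^~ (- 1%:M)); first exact: measurable_preimage_mulmx.
  by apply/funext => x; rewrite mulmxN mulmx1.
have mM (C : set 'rV[R]_n) : measurable C -> measurable (mulmx^~ M @^-1` C).
  exact: measurable_preimage_mulmx.
pose P := ('rV[R]_n * 'rV[R]_n)%type.
have mfst (C : set 'rV[R]_n) : measurable C -> measurable [set p : P | C p.1].
  by move=> mC; apply: (measurable_preimage (f := fst)) => //; exact: measurable_fst.
have msub (C : set 'rV[R]_n) : measurable C -> measurable [set p : P | C (p.1 - p.2 *m M)].
  move=> mC; rewrite (_ : [set p | _] =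
      (fun p : P => p.1 + p.2 *m - M) @^-1` C); last first.
    by apply/seteqP; split => p /=; rewrite mulmxN.
  by apply: measurable_preimage mC; exact: measurable_rV_add_mulmx.
have madd (C : set 'rV[R]_n) : measurable C -> measurable [set p : P | C (p.1 + p.2 *m M)].
  move=> mC; apply: (measurable_preimage (f := fun p : P => p.1 + p.2 *m M)) => //.
  exact: measurable_rV_add_mulmx.
pose E : set P := [set p | A p.1 /\ B (p.1 + p.2 *m M)].
pose F : set P := [set p | B p.1 /\ A (p.1 - p.2 *m M)].
have mE : measurable E by apply: measurableI; [exact: mfst|exact: madd].
have mF : measurable F by apply: measurableI; [exact: mfst|exact: msub].
transitivity (\int[@lebesgue_rV R n]_x lebesgue_rV (xsection E x))%E.
  apply/esym/integral_lebesgue_rV_indic => // x Ax; rewrite xsectionE.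
    rewrite -[RHS](lebesgue_rV_translate (x *m N)); last exact: mM.
    congr (lebesgue_rV _).
    apply/seteqP; split => y; rewrite /preimage /mkset /E /= mulmxDl -mulmxA NM mulmx1 addrC.
      by case.
    by split.
  by rewrite (_ : _ @^-1` E = set0) ?measure0//; apply/seteqP; split => y // -[].
transitivity (\int[@lebesgue_rV R n]_x lebesgue_rV (xsection F x))%E; last first.
  apply/integral_lebesgue_rV_indic => // x Bx; rewrite xsectionE.
    rewrite -[RHS](lebesgue_rV_translate (- (x *m N))); last by apply: mM; exact: mNA.
    congr (lebesgue_rV _); apply/seteqP.
    split => y; rewrite /preimage /mkset /F /= mulmxBl -mulmxA NM mulmx1 opprB.
      by case.
    by split.
  by rewrite (_ : _ @^-1` F = set0) ?measure0//; apply/seteqP; split => y // -[].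
rewrite !tonelli_sections//; apply: eq_integral => y _.
rewrite -[RHS](lebesgue_rV_translate (y *m M)); last exact: measurable_ysection.
congr (lebesgue_rV _); apply/seteqP; rewrite !ysectionE.
by split => x; rewrite /preimage /mkset /E /F /= addrK => -[].
Qed.

(** * Inner product, continuity and compactness *)

Section dot_product.
Variables (R : realType) (n : nat).
Implicit Types x y z : 'rV[R]_n.

Lemma dotvE x y : dotv x y = \sum_i x ord0 i * y ord0 i.
Proof. by rewrite /dotv mxE; apply: eq_bigr => i _; rewrite mxE. Qed.

Lemma dotvC x y : dotv x y = dotv y x.
Proof. by rewrite !dotvE; apply: eq_bigr => i _; rewrite mulrC. Qed.

Lemma dotvDl x y z : dotv (x + y) z = dotv x z + dotv y z.
Proof. by rewrite /dotv mulmxDl mxE. Qed.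

Lemma dotvZl (a : R) x y : dotv (a *: x) y = a * dotv x y.
Proof. by rewrite /dotv -scalemxAl mxE. Qed.

Lemma dotvNl x y : dotv (- x) y = - dotv x y.
Proof. by rewrite -scaleN1r dotvZl mulN1r. Qed.

Lemma dotvDr x y z : dotv x (y + z) = dotv x y + dotv x z.
Proof. by rewrite dotvC dotvDl !(dotvC x). Qed.

Lemma dotvZr (a : R) x y : dotv x (a *: y) = a * dotv x y.
Proof. by rewrite dotvC dotvZl dotvC. Qed.

Lemma dotvNr x y : dotv x (- y) = - dotv x y.
Proof. by rewrite dotvC dotvNl dotvC. Qed.

Lemma dotv0l x : dotv 0 x = 0.
Proof. by rewrite -(scale0r 0) dotvZl mul0r. Qed.

Lemma dotv0r x : dotv x 0 = 0.
Proof. by rewrite dotvC dotv0l. Qed.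

Lemma dotv_ge0 x : 0 <= dotv x x.
Proof. by rewrite dotvE sumr_ge0// => i _; rewrite -expr2 sqr_ge0. Qed.

Lemma sqr_coord_le_dotv x i : x ord0 i ^+ 2 <= dotv x x.
Proof.
rewrite dotvE (bigD1 i)//= -expr2 lerDl sumr_ge0// => j _.
by rewrite -expr2 sqr_ge0.
Qed.

Lemma dotv_eq0 x : (dotv x x == 0) = (x == 0).
Proof.
apply/eqP/eqP => [x0|->]; last exact: dotv0l.
apply/rowP => i; rewrite mxE; apply/eqP; rewrite -sqrf_eq0 eq_le sqr_ge0 andbT.
by rewrite -x0 sqr_coord_le_dotv.
Qed.

Lemma dotv_gt0 x : (0 < dotv x x) = (x != 0).
Proof. by rewrite lt_def dotv_ge0 andbT dotv_eq0. Qed.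

Lemma dotv_mulmx (m : nat) (x : 'rV[R]_m) (y : 'rV[R]_n) (A : 'M[R]_(m, n)) :
  dotv (x *m A) y = dotv x (y *m A^T).
Proof. by rewrite /dotv trmx_mul trmxK mulmxA. Qed.

End dot_product.

Lemma continuous_rV (R : realType) (T : topologicalType) (n : nat)
    (f : T -> 'rV[R]_n) :
  (forall i, continuous (fun x => f x ord0 i)) -> continuous f.
Proof.
move=> cf x; apply/cvg_ballP => e e0.
have : \forall y \near x, forall i : 'I_n, ball (f x ord0 i) e (f y ord0 i).
  apply: filter_forall => i; have /cvg_ballP := cf i x; exact.
by apply: filterS => y fy; split => // i j; rewrite (ord1 i).
Qed.

Lemma continuous_mul (R : realType) (T : topologicalType) (f g : T -> R) :
  continuous f -> continuous g -> continuous (fun x => f x * g x).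
Proof. by move=> cf cg x; apply: cvgM; [exact: cf|exact: cg]. Qed.

Lemma continuous_const (S T : topologicalType) (c : S) :
  continuous (fun _ : T => c).
Proof. by move=> x; exact: cvg_cst. Qed.

Lemma continuous_sum (R : realType) (T : topologicalType) (I : finType)
    (f : I -> T -> R) :
  (forall i, continuous (f i)) -> continuous (fun x => \sum_i f i x).
Proof.
move=> cf; suff : forall s : seq I, continuous (fun x => \sum_(i <- s) f i x).
  by apply.
elim=> [|i s IH] x.
  under eq_fun do rewrite big_nil; exact: cvg_cst.
under eq_fun do rewrite big_cons.
by apply: cvgD; [exact: cf|exact: IH].
Qed.

Lemma coord_rV_continuous (R : realType) (n : nat) (i : 'I_n) :
  continuous (fun x : 'rV[R]_n => x ord0 i).
Proof. exact: coord_continuous. Qed.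

Lemma mulmx_continuous (R : realType) (m n : nat) (A : 'M[R]_(m, n)) :
  continuous (fun x : 'rV[R]_m => x *m A).
Proof.
apply: continuous_rV => i; under eq_fun do rewrite mxE.
apply: continuous_sum => j; apply: continuous_mul.
  exact: coord_rV_continuous.
exact: continuous_const.
Qed.

Lemma dotvr_continuous (R : realType) (n : nat) (y : 'rV[R]_n) :
  continuous (fun x : 'rV[R]_n => dotv x y).
Proof.
under eq_fun do rewrite dotvE.
apply: continuous_sum => j; apply: continuous_mul.
  exact: coord_rV_continuous.
exact: continuous_const.
Qed.

Lemma sqdotv_continuous (R : realType) (n : nat) :
  continuous (fun x : 'rV[R]_n => dotv x x).
Proof.
under eq_fun do rewrite dotvE.
by apply: continuous_sum => j; apply: continuous_mul; exact: coord_rV_continuous.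
Qed.

Lemma closed_measurable_rV (R : realType) (n : nat) (A : set 'rV[R]_n) :
  closed A -> measurable A.
Proof.
move=> cA; rewrite -(setCK A); apply: measurableC; apply: open_measurable_rV.
exact: closed_openC.
Qed.

Lemma compact_measurable_rV (R : realType) (n : nat) (A : set 'rV[R]_n) :
  compact A -> measurable A.
Proof.
by move=> cA; apply: closed_measurable_rV; apply: compact_closed => //; exact: norm_hausdorff.
Qed.

Lemma closed_le_rV (R : realType) (n : nat) (f : 'rV[R]_n -> R) (c : R) :
  continuous f -> closed [set x | f x <= c].
Proof.
move=> cf; rewrite (_ : [set x | _] = f @^-1` [set y | y <= c])//.
by apply: closed_comp => [x _|]; [exact: cf|exact: closed_le].
Qed.

Definition cube (R : realType) (n : nat) (M : R) : set 'rV[R]_n :=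
  rV_box (fun _ => `[- M, M]%classic).

Arguments cube {R} n M.

Lemma cubeP (R : realType) (n : nat) (M : R) (x : 'rV[R]_n) :
  cube n M x <-> forall i, `|x ord0 i| <= M.
Proof. by split=> h i; have := h i; rewrite /= in_itv/= ler_norml. Qed.

Lemma measurable_cube (R : realType) (n : nat) (M : R) : measurable (cube n M).
Proof. by apply: measurable_rV_box => i; exact: measurable_itv. Qed.

Lemma lebesgue_rV_cube (R : realType) (n : nat) (M : R) : 0 <= M ->
  lebesgue_rV (cube n M) = ((M + M) ^+ n)%:E.
Proof.
move=> M0; rewrite lebesgue_rV_box => [|i]; last exact: measurable_itv.
rewrite (eq_bigr (fun=> (M + M)%:E)) => [|i _].
  by rewrite prodEFin prodr_const card_ord.
rewrite lebesgue_measure_itv/= lte_fin; case: ifPn; first by rewrite -EFinB opprK.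
by rewrite -leNgt => M0'; congr EFin; lra.
Qed.

Lemma compact_cube (R : realType) (n : nat) (M : R) : compact (cube n M).
Proof.
rewrite (_ : cube n M = [set v : 'rV[R]_n | forall i, `[- M, M]%classic (v ord0 i)])//.
by apply: (@rV_compact _ _ (fun=> `[- M, M]%classic)) => _; exact: segment_compact.
Qed.

Lemma bounded_sub_cube (R : realType) (n : nat) (A : set 'rV[R]_n) :
  compact A -> exists2 M : R, 0 < M & A `<=` cube n M.
Proof.
move=> /compact_bounded/ex_strict_bound_gt0[M M0 AM]; exists M => // x Ax.
apply/cubeP => i; apply: (le_trans _ (ltW (AM _ Ax))).
rewrite [leRHS]mx_normrE; exact: (le_bigmax _ _ (ord0, i)).
Qed.

(** The swap formula reduces the general set to a cube. *)
Lemma lebesgue_rV_scale (R : realType) (n : nat) (s : R) (A : set 'rV[R]_n) :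
  0 < s -> measurable A -> lebesgue_rV ( *:%R s @^-1` A) = ((s^-1 ^+ n)%:E * lebesgue_rV A)%E.
Proof.
move=> s0 mA.
have sE (C : set 'rV[R]_n) : *:%R s @^-1` C = mulmx^~ (s%:M) @^-1` C.
  by apply/seteqP; split => x /=; rewrite mul_mx_scalar.
have half0 : 0 < 2^-1 :> R by rewrite invr_gt0.
have h := @lebesgue_rV_mulmx_swap R n s%:M s^-1%:M (cube n 2^-1) A.
have {}h : (lebesgue_rV (cube n 2^-1) * lebesgue_rV ( *:%R s @^-1` A) =
  lebesgue_rV A * lebesgue_rV ( *:%R s @^-1` (-%R @^-1` cube n 2^-1)))%E.
  rewrite !sE h//; last exact: measurable_cube.
  by rewrite -scalar_mxM mulVf// gt_eqF.
have sC : *:%R s @^-1` (-%R @^-1` cube n 2^-1) = cube n (2^-1 / s).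
  apply/seteqP; split => x /=; rewrite /preimage /mkset => /cubeP xC; apply/cubeP => i.
    have := xC i; rewrite !mxE normrN normrM gtr0_norm// => h1.
    by rewrite ler_pdivlMr// mulrC.
  by have := xC i; rewrite !mxE normrN normrM gtr0_norm// ler_pdivlMr// mulrC.
move: h; rewrite sC !lebesgue_rV_cube ?divr_ge0 ?ltW//.
have -> : 2^-1 + 2^-1 = 1 :> R by lra.
have -> : 2^-1 / s + 2^-1 / s = s^-1 by field; rewrite gt_eqF.
by rewrite expr1n mul1e muleC.
Qed.

Lemma scale_image_preimage (R : realType) (n : nat) (s : R) (A : set 'rV[R]_n) :
  0 < s -> [set s *: x | x in A] = *:%R s^-1 @^-1` A.
Proof.
move=> s0; apply/seteqP; split => x /=.
  by move=> [y Ay <-]; rewrite scalerK// gt_eqF.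
by move=> Ax; exists (s^-1 *: x) => //; rewrite scalerKV// gt_eqF.
Qed.

Lemma measurable_scale (R : realType) (n : nat) (s : R) (A : set 'rV[R]_n) :
  0 < s -> measurable A -> measurable [set s *: x | x in A].
Proof.
move=> s0 mA; rewrite scale_image_preimage//.
rewrite (_ : *:%R s^-1 = mulmx^~ (s^-1%:M)); first exact: measurable_preimage_mulmx.
by apply/funext => x; rewrite mul_mx_scalar.
Qed.

Lemma lebesgue_rV_scale_image (R : realType) (n : nat) (s : R) (A : set 'rV[R]_n) :
  0 < s -> measurable A ->
  lebesgue_rV [set s *: x | x in A] = ((s ^+ n)%:E * lebesgue_rV A)%E.
Proof.
move=> s0 mA; rewrite scale_image_preimage// lebesgue_rV_scale ?invr_gt0//.
by rewrite invrK.
Qed.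

Definition euclidean_ball (R : realType) (n : nat) : set 'rV[R]_n :=
  [set x | dotv x x <= 1].
Arguments euclidean_ball {R} n.

Lemma measurable_euclidean_ball (R : realType) (n : nat) :
  measurable (@euclidean_ball R n).
Proof. by apply: closed_measurable_rV; apply: closed_le_rV; exact: sqdotv_continuous. Qed.

Lemma lebesgue_rV_euclidean_ball (R : realType) (n : nat) :
  (0 < lebesgue_rV (@euclidean_ball R n) < +oo)%E.
Proof.
have mE := @measurable_euclidean_ball R n.
apply/andP; split.
  apply: (@lt_le_trans _ _ (lebesgue_rV (cube n (n.+1%:R^-1 : R)))).
    by rewrite lebesgue_rV_cube// lte_fin exprn_gt0// addr_gt0.
  apply: le_measure; rewrite ?inE//; first exact: measurable_cube.
  move=> x /cubeP xC; rewrite /euclidean_ball/= dotvE.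
  apply: (@le_trans _ _ (\sum_(i < n) n.+1%:R^-1)).
    apply: ler_sum => i _; rewrite -expr2 -real_normK ?num_real//.
    rewrite expr2 (le_trans (ler_pM _ _ (xC i) (xC i)))//.
    by rewrite ler_piMr// invf_le1// ler1n.
  by rewrite sumr_const card_ord -[leLHS]mulr_natl ler_pdivrMr// mul1r ler_nat.
apply: (@le_lt_trans _ _ (lebesgue_rV (cube n (1 : R)))); last first.
  by rewrite lebesgue_rV_cube// ltry.
apply: le_measure; rewrite ?inE//; first exact: measurable_cube.
move=> x xE; apply/cubeP => i; rewrite -[leRHS]normr1 -ler_sqr ?nnegrE//.
rewrite real_normK ?num_real// normr1 expr1n.
exact: le_trans (sqr_coord_le_dotv _ _) xE.
Qed.

(** A linear isometry preserves Lebesgue measure because it preserves that of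
    the Euclidean ball. *)
Lemma lebesgue_rV_isometry (R : realType) (n : nat) (O : 'M[R]_n)
    (A : set 'rV[R]_n) : O *m O^T = 1%:M -> measurable A ->
  lebesgue_rV (mulmx^~ O @^-1` A) = lebesgue_rV A.
Proof.
move=> OO mA; have [E0 Eoo] := andP (@lebesgue_rV_euclidean_ball R n).
have h := @lebesgue_rV_mulmx_swap R n O O^T (euclidean_ball n) A
  (mulmx1C OO) (@measurable_euclidean_ball R n) mA.
have EO : mulmx^~ O @^-1` (-%R @^-1` euclidean_ball n) = @euclidean_ball R n.
  apply/seteqP; split => x;
  by rewrite /preimage /euclidean_ball /mkset dotvNl dotvNr opprK dotv_mulmx -mulmxA OO mulmx1.
have Efin : lebesgue_rV (@euclidean_ball R n) \is a fin_num.
  by rewrite ge0_fin_numE// ltW.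
move: h; rewrite EO muleC => h; apply/eqP.
by rewrite eq_le; apply/andP; split; rewrite -(lee_pmul2r Efin E0) h lexx.
Qed.

Section slices.
Variables (R : realType) (m : nat) (xi : 'rV[R]_m.+1) (B : 'M[R]_(m, m.+1)).
Hypotheses (xi1 : sphere xi) (xiB : B *m B^T = 1%:M /\ B *m xi^T = 0).

Let xx : xi *m xi^T = 1%:M.
Proof. by rewrite [LHS]mx11_scalar; congr (_%:M). Qed.

Definition frame_map (p : measurableTypeR R * 'rV[R]_m) : 'rV[R]_m.+1 :=
  p.1 *: xi + p.2 *m B.

Let O : 'M[R]_m.+1 := col_mx xi B.

Let OO : O *m O^T = 1%:M.
Proof.
have h : xi *m B^T = 0 by rewrite -[LHS]trmxK trmx_mul trmxK xiB.2 trmx0.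
suff : col_mx xi B *m (col_mx xi B)^T = (1%:M : 'M[R]_(1 + m)) by [].
by rewrite tr_col_mx mul_col_row xx !xiB.1 !xiB.2 h -scalar_mx_block.
Qed.

Lemma frame_mapE p : frame_map p = rV_cons p *m O.
Proof.
rewrite /frame_map -mul_scalar_mx; apply/esym.
exact: (mul_row_col (p.1)%:M p.2 xi B).
Qed.

Lemma measurable_frame_map : measurable_fun setT frame_map.
Proof.
rewrite (_ : frame_map = mulmx^~ O \o @rV_cons R m); last first.
  by apply/funext => p; rewrite frame_mapE.
by apply: measurableT_comp; [exact: measurable_mulmx|exact: measurable_rV_cons].
Qed.

Lemma lebesgue_rV_frame (A : set 'rV[R]_m.+1) : measurable A ->
  lebesgue_rV A = (lebesgue_measure \x @lebesgue_rV R m)%E (frame_map @^-1` A).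
Proof.
move=> mA; rewrite -(lebesgue_rV_isometry OO mA)/= /pushforward.
by congr (_ _); apply/seteqP; split => p; rewrite /preimage /mkset frame_mapE.
Qed.

Lemma lebesgue_rV_slices (A : set 'rV[R]_m.+1) : measurable A ->
  (lebesgue_rV A =
  \int[lebesgue_measure]_s lebesgue_rV [set y : 'rV[R]_m | A (s *: xi + y *m B)%R])%E.
Proof.
move=> mA; rewrite lebesgue_rV_frame//; apply: eq_integral => s _ /=.
by congr (lebesgue_rV _); rewrite xsectionE.
Qed.

Lemma lebesgue_rV_lines (A : set 'rV[R]_m.+1) : measurable A ->
  (lebesgue_rV A = \int[@lebesgue_rV R m]_y
    lebesgue_measure [set s : measurableTypeR R | A (s *: xi + y *m B)%R])%E.
Proof.
move=> mA; rewrite lebesgue_rV_frame//.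
have mA' : measurable (frame_map @^-1` A).
  by apply: measurable_preimage mA; exact: measurable_frame_map.
rewrite -[LHS]/(\int[lebesgue_measure]_s lebesgue_rV (xsection _ s))%E.
rewrite (tonelli_sections lebesgue_measure (@lebesgue_rV R m))//.
apply: eq_integral => y _ /=.
by congr (lebesgue_measure _); rewrite ysectionE.
Qed.

Lemma measurable_slice (A : set 'rV[R]_m.+1) (s : R) : measurable A ->
  measurable [set y : 'rV[R]_m | A (s *: xi + y *m B)].
Proof.
move=> mA; rewrite (_ : [set y | _] = (fun y => y *m B + s *: xi) @^-1` A).
  by apply: measurable_preimage mA; exact: measurable_mulmxD.
by apply/seteqP; split => y; rewrite /preimage /mkset addrC.
Qed.

Lemma measurable_fun_slice (A : set 'rV[R]_m.+1) : measurable A ->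
  measurable_fun setT
    (fun s : measurableTypeR R => lebesgue_rV [set y : 'rV[R]_m | A (s *: xi + y *m B)]).
Proof.
move=> mA; have mA' : measurable (frame_map @^-1` A).
  by apply: measurable_preimage mA; exact: measurable_frame_map.
have := measurable_fun_xsection (@lebesgue_rV R m) mA'.
by congr (measurable_fun _ _); apply/funext => s /=; rewrite xsectionE.
Qed.

Lemma measurable_fun_line (A : set 'rV[R]_m.+1) : measurable A ->
  measurable_fun setT (fun y : 'rV[R]_m =>
    lebesgue_measure [set s : measurableTypeR R | A (s *: xi + y *m B)]).
Proof.
move=> mA; have mA' : measurable (frame_map @^-1` A).
  by apply: measurable_preimage mA; exact: measurable_frame_map.
have := measurable_fun_ysection lebesgue_measure mA'.
by congr (measurable_fun _ _); apply/funext => s /=; rewrite ysectionE.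
Qed.

End slices.

(** * Minkowski sums and volume of compact convex sets *)

Lemma convex_setP (R : realType) (n : nat) (A : set 'rV[R]_n) :
  convex_set A <-> (forall (x y : 'rV[R]_n) (t : R), A x -> A y -> 0 <= t <= 1 ->
    A (t *: x + (1 - t) *: y)).
Proof.
split=> [cA x y t Ax Ay /andP[t0 t1]|cA x y t /set_mem Ax /set_mem Ay].
  have t01 : t \in `[0, 1] by rewrite in_itv/= t0.
  pose l : {i01 R} := Itv01 t0 t1.
  by have /set_mem := cA x y l (mem_set Ax) (mem_set Ay).
apply/mem_set; apply: cA => //.
by rewrite ge0/= le1.
Qed.

Lemma continuous_addr (R : realType) (V : normedModType R) (v : V) :
  continuous (fun x => x + v).
Proof. by move=> x; apply: cvgD; [exact: cvg_id|exact: cvg_cst]. Qed.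

Section minkowski.
Variables (R : realType) (n : nat).
Implicit Types A B K : set 'rV[R]_n.

Definition compact_convex K := compact K /\ convex_set K.

Definition sumset A B : set 'rV[R]_n := [set p.1 + p.2 | p in A `*` B].

Lemma sumsetP A B z : sumset A B z <-> exists x y, [/\ A x, B y & z = x + y].
Proof.
split=> [[[x y] [/= Ax By] <-]|[x [y [Ax By ->]]]]; first by exists x, y.
by exists (x, y).
Qed.

Lemma sumsetS A A' B B' : A `<=` A' -> B `<=` B' -> sumset A B `<=` sumset A' B'.
Proof. by move=> sA sB _ [[x y] [/= /sA ? /sB ?] <-]; exists (x, y). Qed.

Lemma compact_convex_sumset A B :
  compact_convex A -> compact_convex B -> compact_convex (sumset A B).
Proof.
move=> [cA vA] [cB vB]; split.
  apply: continuous_compact; last exact: compact_setX.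
  by apply: continuous_subspaceT => p; exact: add_continuous.
apply/convex_setP => _ _ t [[x y] [/= Ax By] <-] [[x' y'] [/= Ax' By'] <-] t01.
apply/sumsetP; exists (t *: x + (1 - t) *: x'), (t *: y + (1 - t) *: y'); split.
- by move/convex_setP : vA; exact.
- by move/convex_setP : vB; exact.
- by rewrite !scalerDr addrACA.
Qed.

Lemma compact_convex_scale (s : R) K : compact_convex K ->
  compact_convex [set s *: x | x in K].
Proof.
move=> [cK vK]; split.
  apply: continuous_compact cK; apply: continuous_subspaceT => x.
  exact: scaler_continuous.
apply/convex_setP => _ _ t [x Kx <-] [y Ky <-] t01.
exists (t *: x + (1 - t) *: y); first by move/convex_setP : vK; exact.
by rewrite scalerDr !scalerA mulrC [s * (1 - t)]mulrC.
Qed.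

Lemma compact_convex_translate (v : 'rV[R]_n) K : compact_convex K ->
  compact_convex [set x + v | x in K].
Proof.
move=> [cK vK]; split.
  apply: continuous_compact cK; apply: continuous_subspaceT => x.
  exact: continuous_addr.
apply/convex_setP => _ _ t [x Kx <-] [y Ky <-] t01.
exists (t *: x + (1 - t) *: y); first by move/convex_setP : vK; exact.
by rewrite !scalerDr addrACA -[t *: v + _]scalerDl [t + _]addrC subrK scale1r.
Qed.

Lemma compact_convex_mulmx (m : nat) (M : 'M[R]_(n, m)) K : compact_convex K ->
  compact (([set x *m M | x in K]) : set 'rV[R]_m) /\
  convex_set (([set x *m M | x in K]) : set 'rV[R]_m).
Proof.
move=> [cK vK]; split.
  apply: continuous_compact cK; apply: continuous_subspaceT => x.
  exact: mulmx_continuous.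
apply/convex_setP => _ _ t [x Kx <-] [y Ky <-] t01.
exists (t *: x + (1 - t) *: y); first by move/convex_setP : vK; exact.
by rewrite mulmxDl -!scalemxAl.
Qed.

Lemma lebesgue_rV_fin_num K : compact K -> lebesgue_rV K \is a fin_num.
Proof.
move=> cK; have [M M0 KM] := bounded_sub_cube cK.
rewrite ge0_fin_numE//; apply: (@le_lt_trans _ _ (lebesgue_rV (cube n M))).
  apply: le_measure => //; rewrite inE; last exact: measurable_cube.
  exact: compact_measurable_rV.
by rewrite lebesgue_rV_cube ?ltry// ltW.
Qed.

Lemma volumeE K : compact K -> lebesgue_rV K = (volume K)%:E.
Proof. by move=> cK; rewrite /volume fineK//; exact: lebesgue_rV_fin_num. Qed.

Lemma volume_ge0 K : 0 <= volume K.
Proof. by rewrite /volume fine_ge0. Qed.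

Lemma volumeS A B : compact A -> compact B -> A `<=` B -> volume A <= volume B.
Proof.
move=> cA cB AB; rewrite -lee_fin -!volumeE//.
by apply: le_measure => //; rewrite inE; exact: compact_measurable_rV.
Qed.

Lemma volume_translate (v : 'rV[R]_n) K : compact_convex K ->
  volume [set x + v | x in K] = volume K.
Proof.
move=> cK; rewrite /volume -[in RHS](lebesgue_rV_translate (- v)).
  congr (fine (lebesgue_rV _)); apply/seteqP; split => x /=.
    by move=> [y Ky <-]; rewrite addrK.
  by move=> Kx; exists (x - v) => //; rewrite subrK.
by apply: compact_measurable_rV; case: cK.
Qed.

Lemma volume_scale (s : R) K : 0 < s -> compact K ->
  volume [set s *: x | x in K] = s ^+ n * volume K.
Proof.
move=> s0 cK; have mK := compact_measurable_rV cK.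
rewrite /volume lebesgue_rV_scale_image// fineM//.
exact: lebesgue_rV_fin_num.
Qed.

End minkowski.

Section frame_decomposition.
Variables (R : realType) (m : nat) (xi : 'rV[R]_m.+1) (B : 'M[R]_(m, m.+1)).
Hypotheses (xi1 : sphere xi) (xiB : B *m B^T = 1%:M /\ B *m xi^T = 0).

Lemma frame_perp : xi *m B^T = 0.
Proof. by rewrite -[LHS]trmxK trmx_mul trmxK xiB.2 trmx0. Qed.

Lemma frame_decomp (x : 'rV[R]_m.+1) : x = dotv x xi *: xi + (x *m B^T) *m B.
Proof.
have xx : xi *m xi^T = 1%:M by rewrite [LHS]mx11_scalar; congr (_%:M).
have OO : col_mx xi B *m (col_mx xi B)^T = 1%:M :> 'M[R]_(1 + m).
  by rewrite tr_col_mx mul_col_row xx !xiB.1 !xiB.2 frame_perp -scalar_mx_block.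
have := mulmx1C OO; rewrite tr_col_mx mul_row_col => OO'.
rewrite -[LHS]mulmx1 -OO' mulmxDr !mulmxA; congr (_ + _).
by rewrite [x *m _]mx11_scalar mul_scalar_mx.
Qed.

Lemma frame_dot (s : R) (y : 'rV[R]_m) : dotv (s *: xi + y *m B) xi = s.
Proof.
by rewrite dotvDl dotvZl dotv_mulmx xi1 mulr1 /dotv trmx_mul trmxK mulmxA -mulmxA xiB.2 mulmx0 mxE addr0.
Qed.

Lemma frame_proj (s : R) (y : 'rV[R]_m) : (s *: xi + y *m B) *m B^T = y.
Proof.
by rewrite mulmxDl -scalemxAl frame_perp scaler0 add0r -mulmxA xiB.1 mulmx1.
Qed.

End frame_decomposition.

(** * Adding a segment to a convex body *)

Lemma continuous_scalel (R : realType) (n : nat) (v : 'rV[R]_n) :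
  continuous (fun s : R => s *: v).
Proof.
apply: continuous_rV => i; under eq_fun do rewrite mxE.
by apply: continuous_mul; [move=> x; exact: cvg_id|exact: continuous_const].
Qed.

Section segments.
Variables (R : realType) (n : nat).
Implicit Types (K : set 'rV[R]_n) (v : 'rV[R]_n).

Definition ray v : set 'rV[R]_n := [set s *: v | s in `[0, 1]%classic].

Definition seg v : set 'rV[R]_n := [set s *: v | s in `[-1, 1]%classic].

Lemma compact_convex_scaled_itv v (a b : R) :
  compact_convex ([set s *: v | s in `[a, b]%classic] : set 'rV[R]_n).
Proof.
split.
  apply: continuous_compact; last exact: segment_compact.
  by apply: continuous_subspaceT; exact: continuous_scalel.
apply/convex_setP => _ _ t [x xab <-] [y yab <-] t01.
exists (t * x + (1 - t) * y); last first.
  by rewrite [LHS]scalerDl !scalerA.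
move: xab yab t01; rewrite /= !in_itv/= => /andP[? ?] /andP[? ?] /andP[? ?].
by apply/andP; split; nra.
Qed.

Lemma compact_convex_ray v : compact_convex (ray v).
Proof. exact: compact_convex_scaled_itv. Qed.

Lemma compact_convex_seg v : compact_convex (seg v).
Proof. exact: compact_convex_scaled_itv. Qed.

Lemma seg_ray v : seg v = [set x - v | x in ray (2 *: v)].
Proof.
apply/seteqP; split => [_ [s s1 <-]|_ [_ [s s1 <-] <-]].
  exists (((s + 1) / 2) *: (2 *: v)).
    exists ((s + 1) / 2) => //; move: s1; rewrite /= !in_itv/= => /andP[? ?].
    by apply/andP; split; lra.
  by rewrite scalerA divfK ?pnatr_eq0// scalerDl scale1r addrK.
exists (2 * s - 1).
  by move: s1; rewrite /= !in_itv/= => /andP[? ?]; apply/andP; split; lra.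
by rewrite scalerBl scale1r scalerA mulrC.
Qed.

Lemma sumset_translater (A B : set 'rV[R]_n) v :
  sumset A [set x + v | x in B] = [set x + v | x in sumset A B].
Proof.
apply/seteqP; split => [_ [[x y] [/= Ax [z Bz <-]] <-]|_ [_ [[x y] [/= Ax By] <-] <-]].
  by exists (x + z); [exists (x, z)|rewrite addrA].
by exists (x, y + v) => /=; [split=> //; exists y|rewrite addrA].
Qed.

Lemma volume_sumset_seg K v : compact_convex K ->
  volume (sumset K (seg v)) = volume (sumset K (ray (2 *: v))).
Proof.
move=> cK; rewrite seg_ray sumset_translater volume_translate//.
by apply: compact_convex_sumset cK _; exact: compact_convex_ray.
Qed.

End segments.

Section line_sections.
Variables (R : realType) (m : nat) (xi : 'rV[R]_m.+1) (B : 'M[R]_(m, m.+1)).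
Hypotheses (xi1 : sphere xi) (xiB : B *m B^T = 1%:M /\ B *m xi^T = 0).

(** The end points are the extrema of <., xi> on the compact fiber of K over
    y, convexity fills the gap. *)
Lemma line_interval (K : set 'rV[R]_m.+1) (y : 'rV[R]_m) : compact_convex K ->
  [set x *m B^T | x in K] y ->
  exists a b : R, a <= b /\ forall s, K (s *: xi + y *m B) <-> a <= s <= b.
Proof.
move=> [cK vK] [x0 Kx0 x0y].
pose S := K `&` [set x | x *m B^T = y].
have cS : compact S.
  apply: compact_closedI => //.
  rewrite (_ : [set x | _] = (mulmx^~ B^T) @^-1` [set y])//.
  apply: closed_comp => [x _|]; first exact: mulmx_continuous.
  by apply: compact_closed; [exact: norm_hausdorff|exact: compact_set1].
have S0 : S !=set0 by exists x0.
have cf : {within S, continuous (fun x => dotv x xi)}.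
  by apply: continuous_subspaceT; exact: dotvr_continuous.
have SE x : S x -> x = dotv x xi *: xi + y *m B.
  by move=> [_ <-]; exact: frame_decomp.
have [p /set_mem Sp pmin] := compact_EVT_min S0 cS cf.
have [q /set_mem Sq qmax] := compact_EVT_max S0 cS cf.
exists (dotv p xi), (dotv q xi); split; first by apply: pmin; exact: mem_set.
move=> s; split => [Ks|/andP[ps sq]].
  have Ss : S (s *: xi + y *m B) by split => //=; rewrite frame_proj.
  have := pmin _ (mem_set Ss); have := qmax _ (mem_set Ss).
  by rewrite frame_dot// => -> ->.
have [pq|pq] := eqVneq (dotv p xi) (dotv q xi).
  have -> : s = dotv p xi by apply/eqP; rewrite eq_le ps pq sq.
  by rewrite -SE//; case: Sp.
have pq0 : 0 < dotv q xi - dotv p xi.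
  by rewrite subr_gt0 lt_neqAle pq (le_trans ps).
pose t := (s - dotv p xi) / (dotv q xi - dotv p xi).
have -> : s *: xi + y *m B = t *: q + (1 - t) *: p.
  rewrite [in RHS](SE q Sq) [in RHS](SE p Sp) !scalerDr addrACA !scalerA -!scalerDl.
  rewrite [t + _]addrC subrK scale1r; congr (_ *: _ + _).
  by rewrite /t; field; rewrite gt_eqF.
move/convex_setP : vK; apply; [by case: Sq|by case: Sp|].
apply/andP; split; first by rewrite divr_ge0 ?subr_ge0// ltW// -subr_gt0.
by rewrite ler_pdivrMr// mul1r lerD2r.
Qed.

(** Each line parallel to xi that meets K meets it in an interval, which the
    sum with a segment of length t in the direction xi lengthens by t. *)
Lemma volume_sumset_ray (K : set 'rV[R]_m.+1) (t : R) : compact_convex K ->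
  0 <= t ->
  volume (sumset K (ray (t *: xi))) = volume K + t * volume [set x *m B^T | x in K].
Proof.
move=> cK t0; have cKr := compact_convex_sumset cK (compact_convex_ray (t *: xi)).
have [cKB vKB] := compact_convex_mulmx B^T cK.
apply: EFin_inj; rewrite EFinD EFinM -!volumeE//; [|by case: cK|by case: cKr].
have mK : measurable K by apply: compact_measurable_rV; case: cK.
have mKr : measurable (sumset K (ray (t *: xi))).
  by apply: compact_measurable_rV; case: cKr.
have mKB := compact_measurable_rV cKB.
rewrite (lebesgue_rV_lines xi1 xiB mK) (lebesgue_rV_lines xi1 xiB mKr).
rewrite muleC -(@integral_lebesgue_rV_indic _ _ _ t%:E
  (fun y => (\1_[set x *m B^T | x in K] y * t)%:E)) ?lee_fin//; first last.
- by move=> y yK; rewrite indicE memNset// mul0r.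
- by move=> y yK; rewrite indicE mem_set// mul1r.
rewrite -ge0_integralD//; first last.
- by apply/measurable_EFinP; apply: measurable_funM => //; exact: measurable_indic.
- by move=> y _; rewrite lee_fin mulr_ge0.
- exact: measurable_fun_line.
apply: eq_integral => y _.
have [yK|yK] := pselect ([set x *m B^T | x in K] y); last first.
  rewrite indicE (memNset yK) mul0r adde0.
  congr (lebesgue_measure _); apply/seteqP; split => s /=.
    move=> [[x _] [/= Kx [r _ <-]] E]; exfalso; apply: yK; exists x => //.
    have := congr1 (mulmx^~ B^T) E; rewrite /= frame_proj//.
    by rewrite mulmxDl -!scalemxAl (frame_perp xiB) !scaler0 addr0.
  by move=> Ks; exfalso; apply: yK; exists (s *: xi + y *m B); rewrite ?frame_proj.
have [a [b [ab KE]]] := line_interval cK yK.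
rewrite indicE (mem_set yK) mul1r.
rewrite (_ : [set s | K (s *: xi + y *m B)] = `[a, b]%classic); last first.
  by apply/seteqP; split => s /=; rewrite in_itv/= => /KE.
rewrite (_ : [set s | sumset K _ _] = `[a, b + t]%classic).
  rewrite !lebesgue_measure_itv/= !lte_fin.
  have [atb|atb] := ltP a (b + t); last first.
    have [->] : t = 0 /\ ~~ (a < b) by rewrite -leNgt; split; lra.
    by rewrite -leNgt => ba; rewrite ltNge ba/= adde0.
  have [ab'|ab'] := ltP a b; first by rewrite -!EFinB -EFinD; congr EFin; ring.
  by rewrite add0e -EFinB; congr EFin; lra.
apply/seteqP; split => s /=; rewrite in_itv/=.
  move=> [[x _] [/= Kx [r r1 <-]] E].
  have xE : x = (s - r * t) *: xi + y *m B.
    by rewrite scalerBl addrAC -E scalerA addrK.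
  move: Kx; rewrite xE => /KE; move: r1; rewrite /= in_itv/= => /andP[? ?] /andP[? ?].
  by apply/andP; split; nra.
move=> /andP[as' sb].
have [sb'|sb'] := leP s b.
  exists (s *: xi + y *m B, 0); last by rewrite /= addr0.
  split => /=; first by apply/KE; rewrite as'.
  by exists 0; rewrite ?scale0r//= in_itv/= lexx ler01.
have t0' : 0 < t by lra.
exists (b *: xi + y *m B, (s - b) *: xi).
  split => /=; first by apply/KE; rewrite ab lexx.
  exists ((s - b) / t); last by rewrite scalerA divfK// gt_eqF.
  by rewrite /= in_itv/= ler_pdivlMr// ler_pdivrMr//; apply/andP; split; lra.
by rewrite /= addrAC -scalerDl [b + _]addrC subrK.
Qed.

End line_sections.

Section projections.
Variables (R : realType) (m : nat).
Implicit Types (K : set 'rV[R]_m.+1) (v xi : 'rV[R]_m.+1).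

Definition enorm (n : nat) (v : 'rV[R]_n) : R := Num.sqrt (dotv v v).

Lemma enorm_ge0 (n : nat) (v : 'rV[R]_n) : 0 <= enorm v.
Proof. exact: sqrtr_ge0. Qed.

Lemma sqr_enorm (n : nat) (v : 'rV[R]_n) : enorm v ^+ 2 = dotv v v.
Proof. by rewrite sqr_sqrtr// dotv_ge0. Qed.

Lemma polar_decomposition v : exists2 xi, sphere xi & v = enorm v *: xi.
Proof.
have [->|v0] := eqVneq v 0.
  exists (delta_mx ord0 ord0).
    rewrite /sphere/= dotvE (bigD1 ord0)//= big1 ?addr0 => [|i i0].
      by rewrite mxE eqxx mul1r.
    by rewrite mxE (negPf i0) andbF mul0r.
  by rewrite /enorm dotv0l sqrtr0 scale0r.
have e0 : enorm v != 0 by rewrite sqrtr_eq0 -ltNge dotv_gt0.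
exists ((enorm v)^-1 *: v); last by rewrite scalerA mulfV// scale1r.
by rewrite /sphere/= dotvZl dotvZr -sqr_enorm mulrA -expr2 exprVn mulVf// expf_neq0.
Qed.

Definition shadow K xi : set 'rV[R]_m := [set x *m (perp_basis xi)^T | x in K].

Lemma compact_convex_shadow K xi : compact_convex K -> compact_convex (shadow K xi).
Proof. by move=> cK; apply: compact_convex_mulmx. Qed.

Lemma projection_functionE K xi : sphere xi ->
  projection_function K xi = volume (shadow K xi).
Proof.
move=> xi1; have xiB := perp_basisP xi1.
rewrite /projection_function /volume; congr (fine (lebesgue_rV _)).
apply/seteqP; split => y.
  move=> [x Kx E]; exists x => //.
  have {}E : (x *m (perp_basis xi)^T) *m perp_basis xi = y *m perp_basis xi.
    by rewrite -E [X in _ = X - _](frame_decomp xi1 xiB) addrC addKr.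
  by rewrite -[LHS]mulmx1 -[RHS]mulmx1 -xiB.1 !mulmxA E.
move=> [x Kx <-]; exists x => //.
by rewrite [X in X - _](frame_decomp xi1 xiB) addrC addKr.
Qed.

Lemma projection_function_ge0 K xi : 0 <= projection_function K xi.
Proof. by rewrite /projection_function fine_ge0. Qed.

Lemma projection_functionS K K' xi : sphere xi ->
  compact_convex K -> compact_convex K' -> K `<=` K' ->
  projection_function K xi <= projection_function K' xi.
Proof.
move=> xi1 cK cK' KK'; rewrite !projection_functionE//; apply: volumeS.
- by have [] := compact_convex_shadow xi cK.
- by have [] := compact_convex_shadow xi cK'.
- by move=> _ [x Kx <-]; exists x => //; exact: KK'.
Qed.

Lemma projection_function_scale K xi (s : R) : sphere xi -> compact_convex K ->
  0 < s ->
  projection_function [set s *: x | x in K] xi = s ^+ m * projection_function K xi.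
Proof.
move=> xi1 cK s0; rewrite !projection_functionE//.
rewrite -volume_scale//; last by have [] := compact_convex_shadow xi cK.
congr volume; apply/seteqP; split => y.
  by move=> [_ [x Kx <-] <-]; exists (x *m (perp_basis xi)^T); [exists x|rewrite scalemxAl].
by move=> [_ [x Kx <-] <-]; exists (s *: x); [exists x|rewrite scalemxAl].
Qed.

Lemma projection_function_translate K xi v : sphere xi -> compact_convex K ->
  projection_function [set x + v | x in K] xi = projection_function K xi.
Proof.
move=> xi1 cK; rewrite !projection_functionE//.
rewrite -[RHS](volume_translate (v *m (perp_basis xi)^T)); last exact: compact_convex_shadow.
congr volume; apply/seteqP; split => y.
  by move=> [_ [x Kx <-] <-]; exists (x *m (perp_basis xi)^T); [exists x|rewrite mulmxDl].
by move=> [_ [x Kx <-] <-]; exists (x + v); [exists x|rewrite mulmxDl].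
Qed.

(** Equal to 2 |v| times the projection function in the direction of v, but
    free from coordinates on the hyperplane and from division by |v|. *)
Definition seg_gain K v : R := volume (sumset K (seg v)) - volume K.

Lemma volume_sumset_ray_sphere K xi (a : R) : sphere xi -> compact_convex K -> 0 <= a ->
  volume (sumset K (ray (a *: xi))) = volume K + a * projection_function K xi.
Proof.
move=> xi1 cK a0; have xiB := perp_basisP xi1.
by rewrite projection_functionE// (volume_sumset_ray xi1 xiB).
Qed.

Lemma seg_gain_sphere K xi (a : R) : sphere xi -> compact_convex K -> 0 <= a ->
  seg_gain K (a *: xi) = 2 * a * projection_function K xi.
Proof.
move=> xi1 cK a0; rewrite /seg_gain volume_sumset_seg// scalerA.
by rewrite volume_sumset_ray_sphere ?mulr_ge0// addrC addKr.
Qed.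

Lemma volume_sumset_ray_gain K v : compact_convex K ->
  volume (sumset K (ray v)) = volume K + seg_gain K v / 2.
Proof.
move=> cK; have [xi xi1 ->] := polar_decomposition v.
have e0 := enorm_ge0 v.
by rewrite volume_sumset_ray_sphere// seg_gain_sphere//; congr (_ + _); field.
Qed.

Lemma seg_gainS K K' v : compact_convex K -> compact_convex K' -> K `<=` K' ->
  seg_gain K v <= seg_gain K' v.
Proof.
move=> cK cK' KK'; have [xi xi1 ->] := polar_decomposition v.
have e0 := enorm_ge0 v.
by rewrite !seg_gain_sphere// ler_wpM2l ?mulr_ge0//; exact: projection_functionS.
Qed.

Lemma seg_gain_ge0 K v : compact_convex K -> 0 <= seg_gain K v.
Proof.
move=> cK; have [xi xi1 ->] := polar_decomposition v.
have e0 := enorm_ge0 v.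
by rewrite !seg_gain_sphere// !mulr_ge0// projection_function_ge0.
Qed.

Lemma seg_gain_scale_body K v (s : R) : compact_convex K -> 0 < s ->
  seg_gain [set s *: x | x in K] v = s ^+ m * seg_gain K v.
Proof.
move=> cK s0; have [xi xi1 ->] := polar_decomposition v.
have e0 := enorm_ge0 v; have csK := compact_convex_scale s cK.
by rewrite !seg_gain_sphere// projection_function_scale// mulrCA.
Qed.

Lemma seg_gainZ K v (c : R) : compact_convex K -> 0 <= c ->
  seg_gain K (c *: v) = c * seg_gain K v.
Proof.
move=> cK c0; have [xi xi1 ->] := polar_decomposition v.
have e0 := enorm_ge0 v.
by rewrite scalerA !seg_gain_sphere ?mulr_ge0//; ring.
Qed.

End projections.

(** * Zonotopes *)

Section zonotopes.
Variable R : realType.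

Fixpoint zonotope (n : nat) (us : seq 'rV[R]_n) : set 'rV[R]_n :=
  if us is u :: us' then sumset (seg u) (zonotope us') else [set 0].

Lemma compact_convex_zonotope (n : nat) (us : seq 'rV[R]_n) :
  compact_convex (zonotope us).
Proof.
elim: us => [|u us IH] /=; last first.
  by apply: compact_convex_sumset IH; exact: compact_convex_seg.
split; first exact: compact_set1.
by apply/convex_setP => _ _ t -> -> _; rewrite !scaler0 addr0.
Qed.

Lemma seg0 (n : nat) (u : 'rV[R]_n) : seg u 0.
Proof. by exists 0; rewrite ?scale0r//= in_itv/= lerN10 ler01. Qed.

Lemma zonotope0 (n : nat) (us : seq 'rV[R]_n) : zonotope us 0.
Proof.
elim: us => //= u us IH; apply/sumsetP; exists 0, 0; split => //.
  exact: seg0.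
by rewrite addr0.
Qed.

Lemma sumsetA (n : nat) (A B C : set 'rV[R]_n) :
  sumset (sumset A B) C = sumset A (sumset B C).
Proof.
apply/seteqP; split => z.
  move=> /sumsetP[_ [c [/sumsetP[a [b [Aa Bb ->]]] Cc ->]]].
  apply/sumsetP; exists a, (b + c); split; rewrite ?addrA//.
  by apply/sumsetP; exists b, c.
move=> /sumsetP[a [_ [Aa /sumsetP[b [c [Bb Cc ->]]] ->]]].
apply/sumsetP; exists (a + b), c; split; rewrite ?addrA//.
by apply/sumsetP; exists a, b.
Qed.

Lemma sumset0 (n : nat) (A : set 'rV[R]_n) : sumset A [set 0] = A.
Proof.
apply/seteqP; split => z.
  by move=> /sumsetP[a [_ [Aa -> ->]]]; rewrite addr0.
by move=> Az; apply/sumsetP; exists z, 0; rewrite addr0.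
Qed.

Lemma sub_sumset (n : nat) (A B : set 'rV[R]_n) : B 0 -> A `<=` sumset A B.
Proof. by move=> B0 x Ax; apply/sumsetP; exists x, 0; rewrite addr0. Qed.

Lemma image_sumset_mulmx (m n : nat) (M : 'M[R]_(m, n)) (A B : set 'rV[R]_m) :
  [set x *m M | x in sumset A B] =
  sumset [set x *m M | x in A] [set x *m M | x in B].
Proof.
apply/seteqP; split => z.
  move=> [_ /sumsetP[a [b [Aa Bb ->]]] <-].
  by apply/sumsetP; exists (a *m M), (b *m M); rewrite mulmxDl; split => //; [exists a|exists b].
move=> /sumsetP[_ [_ [[a Aa <-] [b Bb <-] ->]]].
by exists (a + b); rewrite ?mulmxDl//; apply/sumsetP; exists a, b.
Qed.

Lemma image_seg_mulmx (m n : nat) (M : 'M[R]_(m, n)) (u : 'rV[R]_m) :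
  [set x *m M | x in seg u] = seg (u *m M).
Proof.
apply/seteqP; split => z; first by move=> [_ [s s1 <-] <-]; exists s => //; rewrite scalemxAl.
by move=> [s s1 <-]; exists (s *: u); [exists s|rewrite scalemxAl].
Qed.

Lemma zonotope_mulmx (m n : nat) (M : 'M[R]_(m, n)) (us : seq 'rV[R]_m) :
  [set x *m M | x in zonotope us] = zonotope [seq u *m M | u <- us].
Proof.
elim: us => [|u us IH] /=; last by rewrite image_sumset_mulmx IH image_seg_mulmx.
apply/seteqP; split => z; first by move=> [_ -> <-]; rewrite mul0mx.
by move=> ->; exists 0; rewrite ?mul0mx.
Qed.

Lemma zonotopeZ (n : nat) (s : R) (us : seq 'rV[R]_n) :
  [set s *: x | x in zonotope us] = zonotope [seq s *: u | u <- us].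
Proof.
have h := zonotope_mulmx (s%:M) us.
rewrite (_ : [set s *: x | x in zonotope us] = [set x *m s%:M | x in zonotope us]).
  rewrite h; congr zonotope; apply: eq_map => u; exact: mul_mx_scalar.
by congr image; apply/funext => x; rewrite mul_mx_scalar.
Qed.

(** One half of the formula for the support function of a zonotope; it is
    attained, see zonotope_support_attained. *)
Lemma dotv_zonotope (n : nat) (us : seq 'rV[R]_n) (x y : 'rV[R]_n) :
  zonotope us x -> dotv x y <= \sum_(u <- us) `|dotv u y|.
Proof.
elim: us x => [_ ->|u us IH x /sumsetP[_ [b [[s + <-] /IH bus ->]]]].
  by rewrite dotv0l big_nil.
rewrite /= in_itv/= -ler_norml => s1.
rewrite big_cons dotvDl lerD// dotvZl (le_trans (ler_norm _))// normrM.
by rewrite ler_piMl.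
Qed.

Lemma sumset_scale_convex (n : nat) (K : set 'rV[R]_n) (t : R) :
  convex_set K -> 0 <= t ->
  sumset K [set t *: x | x in K] = [set (1 + t) *: x | x in K].
Proof.
move=> /convex_setP vK t0; have t1 : 0 < 1 + t by lra.
apply/seteqP; split => z.
  move=> /sumsetP[x [_ [Kx [y Ky <-] ->]]].
  exists ((1 + t)^-1 *: x + (1 - (1 + t)^-1) *: y).
    apply: vK => //; apply/andP; split; first by rewrite invr_ge0 ltW.
    by rewrite invf_le1//; lra.
  rewrite scalerDr !scalerA mulfV ?gt_eqF// scale1r; congr (_ + _ *: _).
  by rewrite mulrBr mulfV ?gt_eqF//; ring.
move=> [x Kx <-]; apply/sumsetP; exists x, (t *: x).
by rewrite scalerDl scale1r; split => //; exists x.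
Qed.

End zonotopes.

Section elementary_inequalities.
Variable R : realType.

Lemma exprD1_le_quadratic (n : nat) (x : R) : -1 <= x <= 1 ->
  (1 + x) ^+ n <= 1 + n%:R * x + 3 ^+ n * x ^+ 2.
Proof.
move=> /andP[x1 x2]; elim: n => [|n IH]; first by rewrite !expr0; nra.
rewrite exprS; have h : 0 <= 1 + x by lra.
apply: (le_trans (ler_wpM2l h IH)).
have c0 : n%:R <= 3 ^+ n :> R.
  by rewrite -natrX ler_nat; apply: ltnW; exact: ltn_expl.
have n0 : 0 <= n%:R :> R by [].
rewrite [3 ^+ n.+1]exprS -[n.+1]addn1 natrD; set C := 3 ^+ n in c0 *; set N := n%:R in c0 n0 *.
have x20 : 0 <= x ^+ 2 by exact: sqr_ge0.
rewrite -subr_ge0.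
have -> : 1 + (N + 1) * x + 3 * C * x ^+ 2 - (1 + x) * (1 + N * x + C * x ^+ 2) =
  x ^+ 2 * ((C - N) + C * (1 - x)) by ring.
by rewrite mulr_ge0// addr_ge0 ?mulr_ge0 ?subr_ge0//; lra.
Qed.

Lemma bernoulli_le (n : nat) (x : R) : 0 <= x -> 1 + n%:R * x <= (1 + x) ^+ n.
Proof.
move=> x0; elim: n => [|n IH]; first by rewrite expr0 mul0r addr0.
rewrite exprS -[n.+1]addn1 natrD.
have h : 0 <= 1 + x by lra.
apply: le_trans (ler_wpM2l h IH).
have n0 : 0 <= n%:R :> R by [].
nra.
Qed.

(** Comparison of derivatives at 0 of functions that agree there. *)
Lemma ler_first_order (a b c T : R) : 0 <= c -> 0 < T ->
  (forall t, 0 < t -> t <= T -> a * t <= b * t + c * t ^+ 2) -> a <= b.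
Proof.
move=> c0 T0 h; apply/ler_addgt0Pr => e e0.
pose t := Num.min T (e / (c + 1)).
have t0 : 0 < t by rewrite lt_min T0 divr_gt0//; lra.
have t1 : t <= T by rewrite ge_min lexx.
have te : t * (c + 1) <= e.
  by rewrite -ler_pdivlMr ?ge_min ?lexx ?orbT//; lra.
have := h t t0 t1; rewrite expr2 mulrA -mulrDl ler_pM2r// => h1.
by apply: (le_trans h1); rewrite lerD2l; nra.
Qed.

End elementary_inequalities.

Lemma exprD1_small (R : realType) (k : nat) (e : R) : 0 < e ->
  exists2 d : R, 0 < d & (1 + d) ^+ k <= 1 + e.
Proof.
move=> e0; have c0 : 0 <= 3 ^+ k :> R by [].
have k0 : 0 <= k%:R :> R by [].
pose q := 1 + k%:R + 3 ^+ k + e : R.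
have q0 : 0 < q by rewrite /q; lra.
exists (e / q); first by rewrite divr_gt0.
have d0 : 0 < e / q by rewrite divr_gt0.
have d1 : e / q <= 1 by rewrite ler_pdivrMr// /q; lra.
have dq : e / q * q = e by rewrite divfK// gt_eqF.
have hd : -1 <= e / q <= 1 by rewrite d1 andbT; lra.
apply: (le_trans (exprD1_le_quadratic k hd)).
set d := e / q in d0 d1 dq hd *.
have d2 : d ^+ 2 <= d by rewrite expr2; nra.
have := ler_wpM2l c0 d2; rewrite /q in dq; nra.
Qed.

Section zonotope_volume.
Variables (R : realType) (m : nat).
Implicit Types (K : set 'rV[R]_m.+1) (us : seq 'rV[R]_m.+1).

(** Adding the generators one at a time, each adds at least what it would add
    to K because the shadows only grow. *)
Lemma volume_sumset_zonotope_ge K us : compact_convex K ->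
  volume K + \sum_(u <- us) seg_gain K u <= volume (sumset K (zonotope us)).
Proof.
elim: us K => [|u us IH] K cK /=; first by rewrite big_nil addr0 sumset0.
have cKu := compact_convex_sumset cK (compact_convex_seg u).
rewrite big_cons -sumsetA addrA.
have -> : volume K + seg_gain K u = volume (sumset K (seg u)).
  by rewrite /seg_gain addrC subrK.
apply: le_trans (IH _ cKu); rewrite lerD2l; apply: ler_sum => v _.
by apply: seg_gainS => //; apply: sub_sumset; exact: seg0.
Qed.

(** Dually, a generator never adds more than it would add to the larger K'. *)
Lemma volume_sumset_zonotope_le K K' us : compact_convex K -> compact_convex K' ->
  sumset K (zonotope us) `<=` K' ->
  volume (sumset K (zonotope us)) <= volume K + \sum_(u <- us) seg_gain K' u.
Proof.
elim: us K => [|u us IH] K cK cK' /=; first by rewrite big_nil addr0 sumset0.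
have cKu := compact_convex_sumset cK (compact_convex_seg u).
rewrite big_cons -sumsetA addrA => KK'.
apply: (le_trans (IH _ cKu cK' KK')); rewrite lerD2r -lerBlDl.
apply: seg_gainS => //; apply: subset_trans KK'.
apply: (@subset_trans _ (sumset K (seg u))).
  by apply: sub_sumset; exact: seg0.
by apply: sub_sumset; exact: zonotope0.
Qed.

(** Expand the volume of Z + t Z = (1 + t) Z to first order in t. *)
Lemma sum_seg_gain_zonotope us :
  \sum_(u <- us) seg_gain (zonotope us) u <= m.+1%:R * volume (zonotope us).
Proof.
set Z := zonotope us; have cZ : compact_convex Z by exact: compact_convex_zonotope.
have vZ := volume_ge0 Z.
apply: (@ler_first_order _ _ _ (3 ^+ m.+1 * volume Z) 1) => //.
  by rewrite mulr_ge0.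
move=> t t0 t1.
have := volume_sumset_zonotope_ge [seq t *: u | u <- us] cZ.
rewrite -zonotopeZ sumset_scale_convex; [|by case: cZ|exact: ltW].
rewrite volume_scale; [|by lra|by case: cZ].
rewrite big_map (eq_bigr (fun u => t * seg_gain Z u)); last first.
  by move=> u _; rewrite seg_gainZ// ltW.
rewrite -big_distrr/= => h.
have ht : -1 <= t <= 1 by rewrite t1 andbT; lra.
have := ler_wpM2r vZ (exprD1_le_quadratic m.+1 ht); lra.
Qed.

End zonotope_volume.

(** Sum over the generators the volumes of the shadows of Z: the hypothesis is
    inherited by the shadows, and for C the identity it bounds the total
    length of the generators. *)
Lemma volume_zonotope_ge (R : realType) (n : nat) (us : seq 'rV[R]_n) (L : R) :
  0 <= L ->
  (forall k (C : 'M[R]_(k, n)), C *m C^T = 1%:M ->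
     L * k%:R <= \sum_(u <- us) enorm (u *m C^T)) ->
  (2 * L) ^+ n <= volume (zonotope us).
Proof.
elim: n us => [us L0 _|m IH us L0 hus].
  have -> : volume (zonotope us) = fine (\d_(0 : 'rV[R]_0) (zonotope us)) by [].
  by rewrite expr0 diracE mem_set//; exact: zonotope0.
set Z := zonotope us; have cZ : compact_convex Z by exact: compact_convex_zonotope.
have step xi : sphere xi -> (2 * L) ^+ m <= projection_function Z xi.
  move=> xi1; rewrite projection_functionE// /shadow.
  have [] := perp_basisP xi1; move: (perp_basis xi : 'M[R]_(m, m.+1)) => B BB Bxi.
  rewrite zonotope_mulmx; apply: IH => // k C CC.
  rewrite big_map; have := hus k (C *m B).
  rewrite trmx_mul mulmxA -(mulmxA C) BB mulmx1 CC => /(_ erefl).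
  move=> h; apply: (le_trans h).
  by rewrite (eq_bigr (fun u => enorm (u *m B^T *m C^T))) => // u _; rewrite mulmxA.
have n0 : 0 < m.+1%:R :> R by [].
rewrite -(ler_pM2l n0); apply: le_trans (sum_seg_gain_zonotope us); rewrite -/Z.
apply: (@le_trans _ _ (\sum_(u <- us) (2 * (2 * L) ^+ m) * enorm u)).
  rewrite -big_distrr/= exprSr.
  have h : L * m.+1%:R <= \sum_(u <- us) enorm u.
    have := hus m.+1 1%:M; rewrite trmx1 mulmx1 => /(_ erefl) h.
    apply: (le_trans h); apply: ler_sum => u _; by rewrite mulmx1.
  have h2 : 0 <= 2 * (2 * L) ^+ m by rewrite mulr_ge0 ?exprn_ge0 ?mulr_ge0.
  by have := ler_wpM2l h2 h; lra.
apply: ler_sum => u _; have [xi xi1 uE] := polar_decomposition u.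
rewrite [in leRHS]uE seg_gain_sphere//; last exact: enorm_ge0.
by rewrite mulrAC ler_wpM2l ?mulr_ge0 ?enorm_ge0//; exact: step.
Qed.

(** * Brunn-Minkowski inequality *)

Section one_dimensional.
Variable R : realType.
Local Notation leb := (@lebesgue_measure R).

Definition convex_subset (I : set R) :=
  forall x y t, I x -> I y -> 0 <= t <= 1 -> I (t * x + (1 - t) * y).

Lemma lebesgue_measure_ge_itv (H : set (measurableTypeR R)) (a b : R) :
  measurable H -> a <= b -> `[a, b]%classic `<=` H -> ((b - a)%:E <= leb H)%E.
Proof.
move=> mH ab abH.
have : (leb (`[a, b]%classic : set R) <= leb H)%E.
  by apply: le_measure => //; rewrite inE//; exact: measurable_itv.
rewrite lebesgue_measure_itv/= lte_fin; case: ltP ab => // ba ab _.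
have -> : b = a by lra.
by rewrite subrr.
Qed.

(** One-dimensional Brunn-Minkowski inequality, in the case where it is
    elementary: the combination of two intervals contains an interval whose
    length is nearly the combination of their lengths. *)
Lemma brunn_minkowski_itv (I J : set R) (H : set (measurableTypeR R)) (l M : R) :
  0 < l < 1 -> convex_subset I -> convex_subset J -> I !=set0 -> J !=set0 ->
  measurable (I : set (measurableTypeR R)) ->
  measurable (J : set (measurableTypeR R)) ->
  (forall x, I x -> `|x| <= M) -> (forall x, J x -> `|x| <= M) -> measurable H ->
  (forall x y, I x -> J y -> H ((1 - l) * x + l * y)) ->
  ((1 - l)%:E * leb I + l%:E * leb J <= leb H)%E.
Proof.
move=> /andP[l0 l1] vI vJ I0 J0 mI mJ IM JM mH IJH.
have sup_of (A : set R) : A !=set0 -> (forall x, A x -> `|x| <= M) ->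
    measurable (A : set (measurableTypeR R)) ->
    [/\ (leb A <= (sup A - inf A)%:E)%E, has_sup A & has_inf A].
  move=> A0 AM mA.
  have sA : has_sup A by split => //; exists M => x /AM; rewrite ler_norml => /andP[].
  have iA : has_inf A by split => //; exists (- M) => x /AM; rewrite ler_norml => /andP[].
  split => //.
  have Asub : A `<=` `[inf A, sup A]%classic.
    move=> x Ax; rewrite /= in_itv/=; apply/andP; split.
      by apply: ge_inf => //; case: iA.
    by apply: ub_le_sup => //; case: sA.
  have : (leb A <= leb (`[inf A, sup A]%classic : set R))%E.
    by apply: le_measure => //; rewrite inE//; exact: measurable_itv.
  rewrite lebesgue_measure_itv/= lte_fin.
  case: ltP => [_|ba] h; first by rewrite EFinB.
  apply: (le_trans h); rewrite lee_fin subr_ge0; case: A0 => x /Asub.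
  by rewrite /= in_itv/= => /andP[]; exact: le_trans.
have [lI sI iI] := sup_of I I0 IM mI.
have [lJ sJ iJ] := sup_of J J0 JM mJ.
have l1' : 0 < 1 - l by lra.
apply: (@le_trans _ _ ((1 - l) * (sup I - inf I) + l * (sup J - inf J))%:E).
  by rewrite [leRHS]EFinD [X in (_ <= X + _)%E]EFinM [X in (_ <= _ + X)%E]EFinM; apply: leeD; apply: lee_wpmul2l => //; rewrite lee_fin ltW.
apply/lee_addgt0Pr => e e0.
have e2 : 0 < e / 2 by lra.
have [i2 Ii2 i2s] := sup_adherent e2 sI; have [j2 Jj2 j2s] := sup_adherent e2 sJ.
have [i1 Ii1 i1s] := inf_adherent e2 iI; have [j1 Jj1 j1s] := inf_adherent e2 iJ.
pose a := (1 - l) * i1 + l * j1; pose b := (1 - l) * i2 + l * j2.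
have [ab|ba] := leP a b; last first.
  apply: (@le_trans _ _ e%:E); last by rewrite leeDr.
  by rewrite lee_fin; rewrite /a /b in ba; nra.
apply: (@le_trans _ _ (b - a + e)%:E).
  by rewrite lee_fin /a /b; nra.
rewrite EFinD leeD2r//; apply: lebesgue_measure_ge_itv => // s; rewrite /= in_itv/=.
have [->|ab'] := eqVneq a b.
  by rewrite -eq_le => /eqP <-; exact: IJH.
move=> /andP[as' sb].
have ab0 : 0 < b - a by rewrite subr_gt0 lt_neqAle ab' ab.
pose t := (b - s) / (b - a).
have t01 : 0 <= t <= 1.
  by rewrite /t divr_ge0 ?subr_ge0//= ler_pdivrMr// mul1r lerD2l lerN2.
have sE : s = (1 - l) * (t * i1 + (1 - t) * i2) + l * (t * j1 + (1 - t) * j2).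
  have : s = t * a + (1 - t) * b by rewrite /t; field; rewrite gt_eqF.
  by rewrite /a /b => ->; ring.
by rewrite sE; apply: IJH; [exact: vI|exact: vJ].
Qed.

(** The region under the graph of f, sliced in both directions. *)
Lemma layer_cake (f : measurableTypeR R -> R) : measurable_fun setT f ->
  (forall s, 0 <= f s) ->
  (\int[leb]_s (f s)%:E = \int[leb]_t leb [set s | (0 <= t < f s)%R])%E /\
  measurable_fun setT (fun t : measurableTypeR R => leb [set s | 0 <= t < f s]).
Proof.
move=> mf f0.
pose E : set (measurableTypeR R * measurableTypeR R) := [set p | 0 <= p.2 < f p.1].
have mE : measurable E.
  rewrite (_ : E = (fun p => 0 <= p.2) @^-1` [set true] `&`
      (fun p => p.2 < f p.1) @^-1` [set true]); last first.
    by apply/seteqP; split => p; rewrite /E/=; [move=> /andP[]|move=> [-> ->]].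
  apply: measurableI.
  - have h : measurable_fun setT
        (fun p : measurableTypeR R * measurableTypeR R => (0 <= p.2)%R).
      exact: measurable_fun_ler.
    by apply: measurable_preimage h _.
  - have h : measurable_fun setT
        (fun p : measurableTypeR R * measurableTypeR R => (p.2 < f p.1)%R).
      by apply: measurable_fun_ltr => //; apply: measurableT_comp.
    by apply: measurable_preimage h _.
split; last first.
  have := measurable_fun_ysection leb mE.
  by congr (measurable_fun _ _); apply/funext => t /=; rewrite ysectionE.
transitivity (\int[leb]_s leb (xsection E s))%E.
  apply: eq_integral => s _; rewrite xsectionE.
  rewrite (_ : _ @^-1` _ = `[0, f s[%classic); last first.
    by apply/seteqP; split => t; rewrite /= in_itv.
  rewrite lebesgue_measure_itv/= lte_fin; have [fs|fs] := ltP 0 (f s).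
    by rewrite sube0.
  by congr EFin; apply/eqP; rewrite eq_le fs f0.
rewrite tonelli_sections//; apply: eq_integral => t _.
by rewrite ysectionE.
Qed.

(** Prekopa-Leindler inequality for quasi-concave functions.  Normalizing the
    suprema of f and g to 1 makes their level sets nonempty for the same levels
    t, so that the one-dimensional inequality can be integrated in t. *)
Lemma prekopa_normalized (f g h : measurableTypeR R -> R) (l M : R) :
  0 < l < 1 ->
  measurable_fun setT f -> measurable_fun setT g -> measurable_fun setT h ->
  (forall s, 0 <= f s <= 1) -> (forall s, 0 <= g s <= 1) -> (forall s, 0 <= h s) ->
  (forall s, 0 < f s -> `|s| <= M) -> (forall s, 0 < g s -> `|s| <= M) ->
  (forall t, 0 <= t < 1 -> [set s | t < f s] !=set0 /\ convex_subset [set s | t < f s]) ->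
  (forall t, 0 <= t < 1 -> [set s | t < g s] !=set0 /\ convex_subset [set s | t < g s]) ->
  (forall t x y, 0 <= t -> t < f x -> t < g y -> t < h ((1 - l) * x + l * y)) ->
  ((1 - l)%:E * \int[leb]_s (f s)%:E + l%:E * \int[leb]_s (g s)%:E <=
   \int[leb]_s (h s)%:E)%E.
Proof.
move=> l01 mf mg mh f01 g01 h0 fM gM vf vg fgh.
have /andP[l0 l1] := l01.
have f0 s : 0 <= f s by case/andP: (f01 s).
have g0 s : 0 <= g s by case/andP: (g01 s).
have [-> mlf] := layer_cake mf f0; have [-> mlg] := layer_cake mg g0.
have [-> mlh] := layer_cake mh h0.
have l1' : 0 <= 1 - l by lra.
have l0' := ltW l0.
rewrite -!ge0_integralZl ?lee_fin// -ge0_integralD//; first last.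
- by apply: emeasurable_funM => //; exact: measurable_cst.
- by move=> t _; rewrite mule_ge0.
- by apply: emeasurable_funM => //; exact: measurable_cst.
- by move=> t _; rewrite mule_ge0.
apply: ge0_le_integral => //.
- by move=> t _; rewrite adde_ge0// mule_ge0.
- by apply: emeasurable_funD; apply: emeasurable_funM => //; exact: measurable_cst.
move=> t _ /=.
have msup (k : measurableTypeR R -> R) : measurable_fun setT k ->
    measurable ([set s | t < k s] : set (measurableTypeR R)).
  move=> mk; rewrite (_ : [set s | _] = (fun s => t < k s) @^-1` [set true]).
    by apply: measurable_preimage => //; exact: measurable_fun_ltr.
  by apply/seteqP; split => s.
have /orP[t0|t0] : (t < 0) || (0 <= t) by case: leP.
  have k0 (k : measurableTypeR R -> R) : [set s | 0 <= t < k s] = set0.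
    by apply/seteqP; split => s //= /andP[]; rewrite leNgt t0.
  by rewrite !k0 measure0 !mule0 adde0.
have [t1|t1] := ltP t 1; last first.
  rewrite (_ : [set s | 0 <= t < f s] = set0); last first.
    apply/seteqP; split => s //= /andP[_]; rewrite ltNge (le_trans _ t1)//.
    by case/andP: (f01 s).
  rewrite (_ : [set s | 0 <= t < g s] = set0); last first.
    apply/seteqP; split => s //= /andP[_]; rewrite ltNge (le_trans _ t1)//.
    by case/andP: (g01 s).
  by rewrite measure0 !mule0 adde0.
have t01 : 0 <= t < 1 by rewrite t0.
have kE (k : measurableTypeR R -> R) : [set s | 0 <= t < k s] = [set s | t < k s].
  by apply/seteqP; split => s /=; rewrite t0.
rewrite !kE; have [f1 f2] := vf t t01; have [g1 g2] := vg t t01.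
apply: (@brunn_minkowski_itv _ _ _ _ M) => //.
- exact: msup.
- exact: msup.
- by move=> s /= ts; apply: fM; exact: le_lt_trans ts.
- by move=> s /= ts; apply: gM; exact: le_lt_trans ts.
- exact: msup.
- by move=> x y /= tx ty; exact: fgh.
Qed.

End one_dimensional.

Lemma continuous_compT (T U V : topologicalType) (f : T -> U) (g : U -> V) :
  continuous f -> continuous g -> continuous (g \o f).
Proof. by move=> cf cg x; apply: continuous_comp; [exact: cf|exact: cg]. Qed.

Lemma weighted_am_gm (R : realType) (l x y : R) : 0 < l < 1 -> 0 <= x -> 0 <= y ->
  x `^ (1 - l) * y `^ l <= (1 - l) * x + l * y.
Proof.
move=> /andP[l0 l1] x0 y0; have l1' : 0 < 1 - l by lra.
have := @conjugate_powR R (x `^ (1 - l)) (y `^ l) (1 - l)^-1 l^-1.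
rewrite !powR_ge0 !invr_gt0 !invrK => /(_ erefl erefl l1' l0).
rewrite subrK => /(_ erefl).
by rewrite -!powRrM !mulfV ?gt_eqF// !powRr1// [x * _]mulrC [y * _]mulrC.
Qed.

(** A weighted geometric mean is at least the minimum. *)
Lemma powR_mul_gt (R : realType) (l t a b : R) : 0 <= l <= 1 -> 0 <= t ->
  t < a -> t < b -> t < a `^ (1 - l) * b `^ l.
Proof.
move=> /andP[l0 l1] t0 ta tb.
wlog ab : l a b l0 l1 ta tb / a <= b.
  move=> h; have [ab|ba] := leP a b; first exact: h.
  have := h (1 - l) b a; rewrite subKr mulrC; apply=> //; first by lra.
    by lra.
  exact: ltW.
have a0 : 0 < a by apply: le_lt_trans ta.
apply: (lt_le_trans ta).
rewrite -[leLHS]powRr1 ?(ltW a0)// -[X in a `^ X](subrK l) powRD; last by rewrite (gt_eqF a0) implybT.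
rewrite ler_wpM2l ?powR_ge0// ge0_ler_powR// nnegrE ltW//.
exact: lt_le_trans ab.
Qed.

Lemma convex_slice (R : realType) (m : nat) (xi : 'rV[R]_m.+1) (W : 'M[R]_(m, m.+1))
    (A : set 'rV[R]_m.+1) (x y t : R) (u v : 'rV[R]_m) :
  convex_set A -> 0 <= t <= 1 -> A (x *: xi + u *m W) -> A (y *: xi + v *m W) ->
  A ((t * x + (1 - t) * y) *: xi + (t *: u + (1 - t) *: v) *m W).
Proof.
move=> /convex_setP vA t01 Au Av; have := vA _ _ _ Au Av t01.
by rewrite !scalerDr addrACA !scalerA -scalerDl mulmxDl -!scalemxAl.
Qed.

Section slice_volume.
Variables (R : realType) (m : nat) (xi : 'rV[R]_m.+1) (W : 'M[R]_(m, m.+1)).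
Hypotheses (xi1 : sphere xi) (xiW : W *m W^T = 1%:M /\ W *m xi^T = 0).

Definition slice (A : set 'rV[R]_m.+1) (s : R) : set 'rV[R]_m :=
  [set y | A (s *: xi + y *m W)].

Lemma slice_sub_shadow (A : set 'rV[R]_m.+1) (s : R) :
  slice A s `<=` [set x *m W^T | x in A].
Proof. by move=> y Ay; exists (s *: xi + y *m W) => //; rewrite frame_proj. Qed.

Lemma compact_convex_slice (A : set 'rV[R]_m.+1) (s : R) : compact_convex A ->
  compact_convex (slice A s).
Proof.
move=> cA; have [cAW _] := compact_convex_mulmx W^T cA.
case: cA => cA vA; split.
  apply: subclosed_compact cAW _; last exact: slice_sub_shadow.
  rewrite (_ : slice A s = (fun y => y *m W + s *: xi) @^-1` A).
    apply: closed_comp; last by apply: compact_closed => //; exact: norm_hausdorff.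
    have h := continuous_compT (@mulmx_continuous R m m.+1 W) (@continuous_addr R _ (s *: xi)).
    by move=> y _; exact: h.
  by apply/seteqP; split => y; rewrite /slice /preimage /mkset addrC.
apply/convex_setP => u v t Au Av t01; rewrite /slice/=.
have := convex_slice vA t01 Au Av.
by rewrite -mulrDl [t + _]addrC subrK mul1r.
Qed.

Lemma volume_slices (A : set 'rV[R]_m.+1) : compact_convex A ->
  ((volume A)%:E = \int[lebesgue_measure]_s (volume (slice A s))%:E)%E.
Proof.
move=> cA; have [cA' _] := cA; rewrite -volumeE//.
rewrite (lebesgue_rV_slices xi1 xiW); last exact: compact_measurable_rV.
by apply: eq_integral => s _; rewrite -volumeE//; case: (compact_convex_slice s cA).
Qed.

Lemma measurable_volume_slice (A : set 'rV[R]_m.+1) : compact_convex A ->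
  measurable_fun setT (fun s : measurableTypeR R => volume (slice A s)).
Proof.
move=> cA; have [cA' _] := cA.
have := measurable_fun_slice xi W (compact_measurable_rV cA').
move=> h; apply/measurable_EFinP; move: h; congr (measurable_fun _ _).
by apply/funext => s /=; rewrite -volumeE//; case: (compact_convex_slice s cA).
Qed.

Lemma volume_slice_le (A : set 'rV[R]_m.+1) (s : R) : compact_convex A ->
  volume (slice A s) <= volume [set x *m W^T | x in A].
Proof.
move=> cA; apply: volumeS; last exact: slice_sub_shadow.
  by have [] := compact_convex_slice s cA.
by have [] := compact_convex_mulmx W^T cA.
Qed.

Lemma volume_slice_support (A : set 'rV[R]_m.+1) : compact_convex A ->
  exists M : R, forall s, 0 < volume (slice A s) -> `|s| <= M.
Proof.
move=> [cA _]; have [M M0 AM] := bounded_sub_cube cA.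
exists (\sum_i M * `|xi ord0 i|) => s s0.
have [y Ay] : slice A s !=set0.
  apply/set0P; apply: contraTneq s0 => ->.
  by rewrite /volume measure0 ltxx.
rewrite -(frame_dot xi1 xiW s y) dotvE.
apply: (le_trans (ler_norm_sum _ _ _)); apply: ler_sum => i _.
by rewrite normrM ler_wpM2r//; have /cubeP := AM _ Ay; exact.
Qed.

End slice_volume.

(** Multiplicative Brunn-Minkowski inequality, by induction on the dimension:
    the volumes of parallel slices satisfy the hypotheses of the normalized
    one-dimensional inequality after division by their suprema. *)
Theorem brunn_minkowski (R : realType) (n : nat) (A B C : set 'rV[R]_n) (l : R) :
  0 < l < 1 -> compact_convex A -> compact_convex B -> compact_convex C ->
  (forall x y, A x -> B y -> C ((1 - l) *: x + l *: y)) ->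
  0 < volume A -> 0 < volume B ->
  volume A `^ (1 - l) * volume B `^ l <= volume C.
Proof.
elim: n A B C l => [|m IH] A B C l /andP[l0 l1] cA cB cC ABC A0 B0.
  have vol1 (K : set 'rV[R]_0) : K !=set0 -> volume K = 1.
    move=> [x Kx]; have -> : volume K = fine (\d_(0 : 'rV[R]_0) K) by [].
    by rewrite diracE mem_set// (_ : 0 = x)//; apply/rowP => -[].
  have ne (K : set 'rV[R]_0) : 0 < volume K -> K !=set0.
    by move=> K0; apply/set0P; apply: contraTneq K0 => ->; rewrite /volume measure0 ltxx.
  have [x Ax] := ne _ A0; have [y By] := ne _ B0.
  rewrite !vol1 ?powR1 ?mulr1//; [by exists ((1 - l) *: x + l *: y); exact: ABC|exact: ne|exact: ne].
have [xi xi1 _] := polar_decomposition (0 : 'rV[R]_m.+1).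
have := perp_basisP xi1; move: (perp_basis xi : 'M[R]_(m, m.+1)) => W xiW.
have l01 : 0 < l < 1 by rewrite l0.
have l1' : 0 < 1 - l by lra.
pose v (K : set 'rV[R]_m.+1) s := volume (slice xi W K s).
have v0 K s : 0 <= v K s by exact: volume_ge0.
have cs K s : compact_convex K -> compact_convex (slice xi W K s).
  by move=> cK; apply: compact_convex_slice.
have quasi K : compact_convex K -> forall t, 0 <= t -> convex_subset [set s | t < v K s].
  move=> cK t t0 x y p tx ty p01.
  have [->|p0] := eqVneq p 0; first by rewrite mul0r add0r subr0 mul1r.
  have [->|p1] := eqVneq p 1; first by rewrite subrr mul0r addr0 mul1r.
  (* Slices being convex, the inductive inequality applies within one body. *)
  have q01 : 0 < 1 - p < 1.
    move: p01 p0 p1 => /andP[]; rewrite !le_eqVlt eq_sym => /orP[->//|p0] /orP[->//|p1] _ _.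
    by apply/andP; split; lra.
  apply: lt_le_trans (IH _ _ _ _ q01 (cs _ x cK) (cs _ y cK)
    (cs _ (p * x + (1 - p) * y) cK) _ _ _); last 2 first.
  - exact: le_lt_trans tx.
  - exact: le_lt_trans ty.
  - apply: powR_mul_gt => //; first by move: q01 => /andP[? ?]; apply/andP; split; lra.
  - by move=> u w; rewrite subKr; apply: convex_slice => //; case: cK.
pose top K := sup (range (v K)).
have supK K : compact_convex K -> has_sup (range (v K)).
  move=> cK; split; first by exists (v K 0); exists 0.
  exists (volume [set x *m W^T | x in K]) => _ [s _ <-].
  by apply: volume_slice_le.
have le_top K s : compact_convex K -> v K s <= top K.
  by move=> cK; apply: ub_le_sup; [case: (supK _ cK)|exists s].
have volI K : compact_convex K -> ((volume K)%:E = \int[lebesgue_measure]_s (v K s)%:E)%E.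
  by move=> cK; apply: volume_slices.
have top0 K : compact_convex K -> 0 < volume K -> 0 < top K.
  move=> cK; rewrite !ltNge; apply: contra => topK.
  rewrite -lee_fin volI// (_ : \int[_]_s _ = 0)%E//.
  apply: integral0_eq => s _; congr EFin; apply/eqP; rewrite eq_le v0 andbT.
  exact: le_trans (le_top K s cK) topK.
set a := top A; set b := top B.
have a0 : 0 < a by exact: top0.
have b0 : 0 < b by exact: top0.
pose M := a `^ (1 - l) * b `^ l.
have M0 : 0 < M by rewrite mulr_gt0// powR_gt0.
have [MA hMA] := volume_slice_support xi1 xiW cA.
have [MB hMB] := volume_slice_support xi1 xiW cB.
have mv K c : compact_convex K ->
    measurable_fun setT (fun s : measurableTypeR R => c^-1 * v K s).
  move=> cK; apply: measurable_funM; first exact: measurable_cst.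
  exact: measurable_volume_slice.
have cond K (c := top K) : compact_convex K -> 0 < c ->
    forall t, 0 <= t < 1 ->
      [set s | t < c^-1 * v K s] !=set0 /\ convex_subset [set s | t < c^-1 * v K s].
  move=> cK c0 t /andP[t0 t1].
  have E : [set s | t < c^-1 * v K s] = [set s | t * c < v K s].
    by apply/seteqP; split => s /=; rewrite [_^-1 * _]mulrC ltr_pdivlMr.
  rewrite E; split; last by apply: quasi => //; rewrite mulr_ge0// ltW.
  have e0 : 0 < c - t * c by nra.
  have [_ [s _ <-]] := sup_adherent e0 (supK _ cK); rewrite subKr => h.
  by exists s.
have := @prekopa_normalized R (fun s => a^-1 * v A s) (fun s => b^-1 * v B s)
  (fun s => M^-1 * v C s) l (Num.max MA MB) l01 (mv _ _ cA) (mv _ _ cB) (mv _ _ cC).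
have unit K s (c := top K) : compact_convex K -> 0 < c -> 0 <= c^-1 * v K s <= 1.
  move=> cK c0; apply/andP; split; first by rewrite mulr_ge0// invr_ge0 ltW.
  by rewrite ler_pdivrMl// mulr1; exact: le_top.
have pos K s (c : R) : 0 < c -> 0 < c^-1 * v K s -> 0 < v K s.
  by move=> c0; rewrite pmulr_rgt0// invr_gt0.
move=> /(_ (fun s => unit A s cA a0) (fun s => unit B s cB b0)).
have hC s : 0 <= M^-1 * v C s by rewrite mulr_ge0// invr_ge0 ltW.
move=> /(_ hC).
have hA s : 0 < a^-1 * v A s -> `|s| <= Num.max MA MB.
  by move=> /(pos _ _ _ a0) /hMA h; rewrite le_max h.
have hB s : 0 < b^-1 * v B s -> `|s| <= Num.max MA MB.
  by move=> /(pos _ _ _ b0) /hMB h; rewrite le_max h orbT.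
move=> /(_ hA hB (cond _ cA a0) (cond _ cB b0)).
have key t x y : 0 <= t -> t < a^-1 * v A x -> t < b^-1 * v B y ->
    t < M^-1 * v C ((1 - l) * x + l * y).
  move=> t0 tx ty.
  have x0 : 0 < v A x by apply: (pos _ _ _ a0); exact: le_lt_trans tx.
  have y0 : 0 < v B y by apply: (pos _ _ _ b0); exact: le_lt_trans ty.
  have h : v A x `^ (1 - l) * v B y `^ l <= v C ((1 - l) * x + l * y).
    apply: IH => //; [exact: cs|exact: cs|exact: cs|].
    move=> u w Au Bw; rewrite /slice/= mulmxDl -!scalemxAl.
    have := ABC _ _ Au Bw.
    by rewrite !scalerDr addrACA !scalerA -scalerDl.
  rewrite mulrC ltr_pdivlMr//; apply: lt_le_trans h.
  have -> : v A x = a * (a^-1 * v A x) by rewrite mulVKf// gt_eqF.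
  have -> : v B y = b * (b^-1 * v B y) by rewrite mulVKf// gt_eqF.
  set p := a^-1 * v A x in tx *; set q := b^-1 * v B y in ty *.
  have p0 : 0 <= p by rewrite ltW// (le_lt_trans t0).
  have q0 : 0 <= q by rewrite ltW// (le_lt_trans t0).
  rewrite (powRM _ (ltW a0) p0) (powRM _ (ltW b0) q0) mulrACA -/M mulrC.
  by rewrite ltr_pM2l//; apply: powR_mul_gt => //; apply/andP; split; exact: ltW.
move=> /(_ key).
have pull K c : 0 < c -> compact_convex K ->
    (\int[lebesgue_measure]_s (c^-1 * v K s)%:E = (c^-1 * volume K)%:E)%E.
  move=> c0 cK; under eq_integral do rewrite EFinM.
  rewrite ge0_integralZl ?lee_fin ?invr_ge0 ?ltW//; last 2 first.
  - by apply/measurable_EFinP; exact: measurable_volume_slice.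
  - by move=> s _; rewrite lee_fin.
  by rewrite -volI// EFinM.
rewrite !pull// -!EFinM -EFinD lee_fin => h.
have aV0 : 0 <= a^-1 by rewrite invr_ge0 ltW.
have bV0 : 0 <= b^-1 by rewrite invr_ge0 ltW.
have vA0 := ltW A0; have vB0 := ltW B0.
have := le_trans (weighted_am_gm l01 (mulr_ge0 aV0 vA0) (mulr_ge0 bV0 vB0)) h.
rewrite [M^-1 * _]mulrC ler_pdivlMr// => am; apply: le_trans am.
rewrite le_eqVlt; apply/orP; left; apply/eqP.
rewrite (powRM _ aV0 vA0) (powRM _ bV0 vB0) /M.
have aK : a^-1 `^ (1 - l) * a `^ (1 - l) = 1.
  by rewrite -(powRM _ aV0 (ltW a0)) mulVf ?powR1// gt_eqF.
have bK : b^-1 `^ l * b `^ l = 1.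
  by rewrite -(powRM _ bV0 (ltW b0)) mulVf ?powR1// gt_eqF.
have E (p q r s x y : R) : p * r = 1 -> q * s = 1 -> x * y = p * x * (q * y) * (r * s).
  move=> pr qs; transitivity (p * r * (q * s) * (x * y)); last by ring.
  by rewrite pr qs !mul1r.
exact: E.
Qed.

(** * Minkowski's first inequality and Shephard's problem for zonotopes *)

Section minkowski_first_inequality.
Variables (R : realType) (m : nat).
Implicit Types (K : set 'rV[R]_m.+1) (us : seq 'rV[R]_m.+1).

Lemma scale_comp_image (n : nat) (s t : R) (A : set 'rV[R]_n) :
  [set s *: x | x in [set t *: x | x in A]] = [set (s * t) *: x | x in A].
Proof.
apply/seteqP; split => z.
  by move=> [_ [x Ax <-] <-]; exists x => //; rewrite scalerA.
by move=> [x Ax <-]; exists (t *: x); [exists x|rewrite scalerA].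
Qed.

Lemma absorb (n : nat) (K Z : set 'rV[R]_n) (r : R) : 0 < r -> cube n r `<=` K ->
  compact Z -> exists2 rho : R, 0 < rho & Z `<=` [set rho *: x | x in K].
Proof.
move=> r0 rK cZ; have [M M0 ZM] := bounded_sub_cube cZ.
exists (M / r); first by rewrite divr_gt0.
move=> z /ZM /cubeP zM; exists ((r / M) *: z).
  apply: rK; apply/cubeP => i; rewrite mxE normrM gtr0_norm ?divr_gt0//.
  by rewrite mulrAC ler_pdivrMr// ler_wpM2l// ltW.
by rewrite scalerA mulrA divfK ?mulfV ?scale1r// gt_eqF.
Qed.

(** Brunn-Minkowski for bodies of volume 1 compares (1 + t)^n with the volume
    of K + t Z, whose first order term in t is the sum on the right. *)
Lemma minkowski_unit K us (r : R) : compact_convex K -> 0 < r ->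
  cube m.+1 r `<=` K -> volume K = 1 -> volume (zonotope us) = 1 ->
  m.+1%:R <= \sum_(u <- us) seg_gain K u.
Proof.
move=> cK r0 rK K1 Z1; set Z := zonotope us in Z1 *.
have cZ : compact_convex Z by exact: compact_convex_zonotope.
have [rho rho0 ZK] := absorb r0 rK cZ.1.
set S := \sum_(u <- us) _.
have S0 : 0 <= S by apply: sumr_ge0 => u _; exact: seg_gain_ge0.
apply: (@ler_first_order _ _ _ ((m%:R + 3 ^+ m) * S) 1) => //.
  by rewrite mulr_ge0// addr_ge0.
move=> s s0 s1.
(* Chosen so that t Z lies in s K. *)
pose t := s / (1 + rho).
have t0 : 0 < t by rewrite divr_gt0//; lra.
have ts : t * rho <= s.
  by rewrite /t mulrAC ler_pdivrMr; nra.
have tE : t * (1 + rho) = s by rewrite /t divfK// gt_eqF//; lra.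
have t1 : 0 < 1 + t by lra.
pose C := sumset K [set t *: x | x in Z].
have cC : compact_convex C by apply: compact_convex_sumset => //; exact: compact_convex_scale.
have lower : (1 + t) ^+ m.+1 <= volume C.
  have t1V : 0 < (1 + t)^-1 by rewrite invr_gt0.
  (* K + t Z is 1 + t times the combination of K and Z with weights 1 - l, l. *)
  pose l := t / (1 + t).
  have l01 : 0 < l < 1.
    by rewrite /l divr_gt0//= ltr_pdivrMr// mul1r; lra.
  have lE : 1 - l = (1 + t)^-1 by rewrite /l; field; rewrite gt_eqF.
  have lE' : l = (1 + t)^-1 * t by rewrite mulrC.
  have := brunn_minkowski l01 cK cZ (compact_convex_scale (1 + t)^-1 cC).
  rewrite K1 Z1 !powR1 mulr1 volume_scale//; last by case: cC.
  rewrite exprVn ler_pdivlMl ?exprn_gt0// mulr1; apply => //.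
  move=> x y Kx Zy; rewrite lE [X in X *: y]lE' -scalerA -scalerDr.
  exists (x + t *: y) => //; apply/sumsetP; exists x, (t *: y); split => //.
  by exists y.
have x0 : 0 <= t * rho by rewrite mulr_ge0// ltW.
have upper : volume C <= 1 + t * (1 + t * rho) ^+ m * S.
  have := @volume_sumset_zonotope_le R m K [set (1 + t * rho) *: x | x in K]
    [seq t *: u | u <- us] cK (compact_convex_scale _ cK).
  rewrite -zonotopeZ -/C K1 big_map => h; apply: (le_trans (h _)).
    rewrite -sumset_scale_convex//; last by case: cK.
    apply: sumsetS => // _ [z /ZK[x Kx <-] <-]; exists x => //.
    by rewrite scalerA.
  rewrite lerD2l /S big_distrr/=; apply: ler_sum => u _.
  rewrite seg_gain_scale_body//; last by lra.
  by rewrite seg_gainZ// ?(ltW t0)// mulrCA mulrA.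
have bern := bernoulli_le m.+1 (ltW t0).
have quad : (1 + t * rho) ^+ m <= 1 + (m%:R + 3 ^+ m) * s.
  apply: (@le_trans _ _ ((1 + s) ^+ m)).
    by apply: lerXn2r; rewrite ?nnegrE; lra.
  have hs : -1 <= s <= 1 by rewrite s1 andbT; lra.
  apply: (le_trans (exprD1_le_quadratic m hs)).
  have p0 : 0 <= 3 ^+ m :> R by [].
  have s2 : s ^+ 2 <= s by rewrite expr2; nra.
  by have := ler_wpM2l p0 s2; lra.
have step : m.+1%:R * t <= t * (1 + (m%:R + 3 ^+ m) * s) * S.
  have h1 : t * (1 + t * rho) ^+ m * S <= t * (1 + (m%:R + 3 ^+ m) * s) * S.
    by rewrite ler_wpM2r// ler_pM2l.
  lra.
have {}step : m.+1%:R <= (1 + (m%:R + 3 ^+ m) * s) * S.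
  by rewrite -(ler_pM2l t0) [leRHS]mulrA [leLHS]mulrC.
have := ler_wpM2r (ltW s0) step.
by rewrite expr2; lra.
Qed.

(** Minkowski's first inequality: the sum is n times the mixed volume of n - 1
    copies of K and one copy of the zonotope.  Working with the n-th roots a
    and b of the volumes avoids real exponents. *)
Lemma minkowski_zonotope K us (r a b : R) : compact_convex K -> 0 < r ->
  cube m.+1 r `<=` K -> 0 < a -> 0 < b ->
  volume K = a ^+ m.+1 -> volume (zonotope us) = b ^+ m.+1 ->
  m.+1%:R * (a ^+ m * b) <= \sum_(u <- us) seg_gain K u.
Proof.
move=> cK r0 rK a0 b0 Ka Zb.
have aV0 : 0 < a^-1 by rewrite invr_gt0.
have bV0 : 0 < b^-1 by rewrite invr_gt0.
have := @minkowski_unit [set a^-1 *: x | x in K] [seq b^-1 *: u | u <- us] (r / a).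
rewrite -zonotopeZ !volume_scale//; last 2 first.
- by case: cK.
- by case: (compact_convex_zonotope us).
rewrite Ka Zb !exprVn !mulVf ?expf_neq0 ?gt_eqF//.
have sub : cube m.+1 (r / a) `<=` [set a^-1 *: x | x in K].
  move=> x /cubeP xr; exists (a *: x); last by rewrite scalerK// gt_eqF.
  apply: rK; apply/cubeP => i; rewrite mxE normrM gtr0_norm// mulrC.
  by rewrite -ler_pdivlMr.
move=> /(_ (compact_convex_scale _ cK) (divr_gt0 r0 a0) sub erefl erefl).
rewrite big_map (eq_bigr (fun u => (b^-1 * a^-1 ^+ m) * seg_gain K u)); last first.
  move=> u _; rewrite seg_gain_scale_body// seg_gainZ ?(ltW bV0)//; ring.
rewrite -big_distrr/= exprVn -invfM ler_pdivlMl ?mulr_gt0 ?exprn_gt0//.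
by rewrite mulrC [b * _]mulrC.
Qed.

(** Compare Minkowski's first inequality for K with the bound n |Z| for the
    same sum at K = Z. *)
Lemma shephard_zonotope K us (r a b lam : R) : compact_convex K -> 0 < r ->
  cube m.+1 r `<=` K -> 0 < a -> 0 < b -> 0 <= lam ->
  volume K = a ^+ m.+1 -> volume (zonotope us) = b ^+ m.+1 ->
  (forall xi, sphere xi ->
    projection_function K xi <= lam * projection_function (zonotope us) xi) ->
  a ^+ m <= lam * b ^+ m.
Proof.
move=> cK r0 rK a0 b0 lam0 Ka Zb KZ.
have h := minkowski_zonotope cK r0 rK a0 b0 Ka Zb.
have cZ := compact_convex_zonotope us.
have le_sum : \sum_(u <- us) seg_gain K u <= lam * \sum_(u <- us) seg_gain (zonotope us) u.
  rewrite big_distrr/=; apply: ler_sum => u _.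
  have [xi xi1 uE] := polar_decomposition u.
  rewrite {1}uE {2}uE !seg_gain_sphere ?enorm_ge0// mulrCA ler_wpM2l ?mulr_ge0 ?enorm_ge0//.
  exact: KZ.
have h2 := ler_wpM2l lam0 (sum_seg_gain_zonotope us).
have := le_trans h (le_trans le_sum h2); rewrite Zb exprSr.
have n0 : 0 < m.+1%:R :> R by [].
rewrite (mulrCA lam) ler_pM2l// [lam * (_ * b)]mulrA ler_pM2r//.
Qed.

End minkowski_first_inequality.

(** * Separation and approximation by polytopes *)

Section separation.
Variables (R : realType) (n : nat).
Implicit Types (K : set 'rV[R]_n) (x y : 'rV[R]_n).

(** The normal is the vector from the point of K nearest to x. *)
Lemma separation K x : compact_convex K -> K !=set0 -> ~ K x ->
  exists nu c, (forall y, K y -> dotv y nu <= c) /\ c < dotv x nu.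
Proof.
move=> [cK /convex_setP vK] K0 Kx.
have cf : continuous (fun y => dotv (y - x) (y - x)).
  exact: (continuous_compT (@continuous_addr R _ (- x)) (@sqdotv_continuous R n)).
have [p /set_mem Kp pmin] := compact_EVT_min K0 cK (continuous_subspaceT cf).
exists (x - p), (dotv p (x - p)); split; last first.
  rewrite -subr_gt0 -dotvNl -dotvDl dotv_gt0 subr_eq0.
  by apply: contra_notN Kx => /eqP ->.
move=> y Ky; rewrite -subr_le0 -dotvNl -dotvDl.
suff : 2 * dotv (y - p) (x - p) <= 0 by rewrite pmulr_rle0.
apply: (@ler_first_order _ _ _ (dotv (y - p) (y - p)) 1) => //; first exact: dotv_ge0.
move=> t t0 t1.
have t01 : 0 <= t <= 1 by rewrite t1 ltW.
have := pmin _ (mem_set (vK y p t Ky Kp t01)).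
have -> : t *: y + (1 - t) *: p - x = t *: (y - p) - (x - p).
  by apply/rowP => i; rewrite !mxE; ring.
have -> : p - x = - (x - p) by rewrite opprB.
move: (y - p) (x - p) => u w.
rewrite !(dotvDl, dotvDr, dotvZl, dotvZr, dotvNl, dotvNr) (dotvC w u).
lra.
Qed.

End separation.

Section polytopes.
Variables (R : realType) (n : nat).
Implicit Types (L : set 'rV[R]_n) (nus : seq 'rV[R]_n).

Definition polytope nus : set 'rV[R]_n :=
  [set x | forall nu, nu \in nus -> dotv x nu <= 1].

(** The part of a large cube outside the interior of (1 + d) L is compact and
    is covered by the open half-spaces that miss L; finitely many of them cut
    out the polytope. *)
Lemma polytope_approx L (r d : R) : compact_convex L -> 0 < r -> cube n r `<=` L ->
  0 < d ->
  exists nus, [/\ nus != [::], L `<=` polytope nus &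
    polytope nus `<=` [set (1 + d) *: x | x in L]].
Proof.
move=> cL r0 rL d0; have [M M0 LM] := bounded_sub_cube cL.1.
have L0 : L 0 by apply: rL; apply/cubeP => i; rewrite mxE normr0 ltW.
set L1 := [set (1 + d) *: x | x in L].
have sub x : L x -> L1° x.
  move=> Lx; apply/nbhs_ballP; exists (d * r); first by rewrite /= mulr_gt0.
  move=> y [_ xy]; rewrite /L1 -sumset_scale_convex; [|by case: cL|exact: ltW].
  apply/sumsetP; exists x, (y - x); split; rewrite ?subrKC//.
  exists (d^-1 *: (y - x)); last by rewrite scalerKV// gt_eqF.
  apply: rL; apply/cubeP => i; rewrite !mxE normrM gtr0_norm ?invr_gt0//.
  by rewrite ler_pdivrMl// distrC ltW//; exact: xy.
pose A := cube n M `&` ~` L1°.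
have cA : compact A.
  apply: compact_closedI; first exact: compact_cube.
  by apply: open_closedC; exact: open_interior.
pose good := [set nu : 'rV[R]_n | forall y, L y -> dotv y nu <= 1].
move: cA; rewrite compact_cover.
move=> /(_ _ good (fun nu => [set x | 1 < dotv x nu])) [|x [_ Ax]|N Ngood NA].
- move=> nu _; rewrite (_ : [set x | _] = (fun x => dotv x nu) @^-1` [set z | 1 < z])//.
  by apply: open_comp => [x _|]; [exact: dotvr_continuous|exact: open_gt].
- have [nu [c [nuL cx]]] := separation cL (ex_intro _ _ L0) (fun Lx => Ax (sub _ Lx)).
  have c0 : 0 <= c by have := nuL _ L0; rewrite dotv0l.
  pose e := (c + dotv x nu) / 2.
  have e0 : 0 < e by rewrite /e; lra.
  exists (e^-1 *: nu) => [y Ly|] /=; rewrite dotvZr.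
    by rewrite ler_pdivrMl// mulr1 (le_trans (nuL _ Ly))// /e; lra.
  by rewrite ltr_pdivlMl// mulr1 /e; lra.
(* The faces of the cube, which keep the polytope inside it. *)
pose faces (s : R) := [seq (s / M) *: (delta_mx ord0 i : 'rV[R]_n) | i <- enum 'I_n].
have dot_delta x s i : dotv x ((s / M) *: delta_mx ord0 i) = s / M * x ord0 i.
  rewrite dotvZr dotvE (bigD1 i)//= big1 ?addr0 => [|j ji]; rewrite mxE ?eqxx ?mulr1//.
  by rewrite (negPf ji) andbF mulr0.
(* The zero functional imposes nothing; it makes the list visibly nonempty. *)
exists (0 :: finmap.enum_fset N ++ faces 1 ++ faces (-1)); split => //.
  move=> x Lx nu; rewrite in_cons !mem_cat => /orP[/eqP ->|/orP[nuN|]].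
    by rewrite dotv0r.
    by have /set_mem := Ngood _ nuN; exact.
  have /cubeP xM := LM _ Lx.
  case/orP => /mapP[i _ ->]; rewrite dot_delta mulrAC ler_pdivrMr// mul1r.
    by rewrite mul1r (le_trans (ler_norm _)).
  by rewrite mulN1r (le_trans (ler_norm _))// normrN.
move=> x xP.
have xM : cube n M x.
  apply/cubeP => i; rewrite ler_norml; apply/andP; split.
    have := xP ((-1 / M) *: delta_mx ord0 i); rewrite dot_delta mulrAC ler_pdivrMr//.
    rewrite in_cons !mem_cat (map_f (fun i => (-1 / M) *: delta_mx ord0 i)) ?mem_enum ?orbT//.
    by move=> /(_ erefl); lra.
  have := xP ((1 / M) *: delta_mx ord0 i); rewrite dot_delta mulrAC ler_pdivrMr//.
  rewrite in_cons !mem_cat (map_f (fun i => (1 / M) *: delta_mx ord0 i)) ?mem_enum ?orbT//.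
  by move=> /(_ erefl); lra.
apply: interior_subset; apply: contrapT => xL1.
have [nu /= nuN] := NA x (conj xM xL1).
by rewrite ltNge xP// in_cons mem_cat nuN orbT.
Qed.

Lemma compact_convex_polytope nus K : compact K -> polytope nus `<=` K ->
  compact_convex (polytope nus).
Proof.
move=> cK PK; split.
  apply: subclosed_compact cK PK.
  rewrite (_ : polytope nus = \bigcap_(nu in [set` nus]) [set x | dotv x nu <= 1]).
    by apply: closed_bigI => nu _; apply: closed_le_rV; exact: dotvr_continuous.
  by apply/seteqP; split => x xP nu; exact: xP.
apply/convex_setP => x y t xP yP /andP[t0 t1] nu nuP.
have := xP _ nuP; have := yP _ nuP.
by rewrite dotvDl !dotvZl; nra.
Qed.

End polytopes.

(** * Cauchy's projection formula for polytopes *)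

Lemma measurable_fun_dotv (R : realType) (n : nat) (v : 'rV[R]_n) :
  measurable_fun [set: 'rV[R]_n] (fun x => dotv x v).
Proof.
under eq_fun do rewrite dotvE.
apply: measurable_sum => j; apply: measurable_funM; last exact: measurable_cst.
exact: measurable_rV_coord.
Qed.

Lemma measurable_ltdotv (R : realType) (n : nat) (u v : 'rV[R]_n) :
  measurable [set x | dotv x u < dotv x v].
Proof.
have h := measurable_fun_ltr (@measurable_fun_dotv R n u) (@measurable_fun_dotv R n v).
rewrite (_ : [set x | _] = (fun x => dotv x u < dotv x v) @^-1` [set true]).
  by apply: measurable_preimage h _.
by apply/seteqP; split.
Qed.

Lemma measurable_ledotv (R : realType) (n : nat) (u v : 'rV[R]_n) :
  measurable [set x | dotv x u <= dotv x v].
Proof.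
rewrite (_ : [set x | _] = ~` [set x | dotv x v < dotv x u]).
  by apply: measurableC; exact: measurable_ltdotv.
by apply/seteqP; split => x /=; rewrite ltNge; [move=> ->|move/negP; rewrite negbK].
Qed.

Section cauchy_formula.
Variables (R : realType) (m : nat) (nus : seq 'rV[R]_m.+1).
Hypothesis nus0 : nus != [::].
Local Notation P := (polytope nus).
Hypothesis cP : compact_convex P.

Local Notation N := (size nus).
Local Notation nu i := (nth 0 nus i).

(** The cone over the i-th facet of P; ties go to the smallest index so that
    the cones partition the space. *)
Definition facet_cone (i : nat) : set 'rV[R]_m.+1 :=
  [set x | (i < N)%N /\ forall j, (j < N)%N ->
    if (j < i)%N then dotv x (nu j) < dotv x (nu i)
    else dotv x (nu j) <= dotv x (nu i)].

Lemma facet_cone_max i j x : facet_cone i x -> (j < N)%N ->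
  dotv x (nu j) <= dotv x (nu i).
Proof. by move=> [_ h] jN; have := h _ jN; case: ifP => // _ /ltW. Qed.

Lemma facet_cone_scale i x (s : R) : 0 < s -> facet_cone i x -> facet_cone i (s *: x).
Proof.
move=> s0 [iN h]; split => // j jN; have := h _ jN.
by rewrite !dotvZl ltr_pM2l// ler_pM2l.
Qed.

Lemma facet_cone_cover x : exists i, facet_cone i x.
Proof.
have N0 : (0 < N)%N by rewrite lt0n size_eq0.
pose top i := (i < N)%N && all (fun v => dotv x v <= dotv x (nu i)) nus.
have ex_top : exists i, top i.
  pose i0 : 'I_N := Ordinal N0.
  have [i _ imax] := @Order.TotalTheory.arg_maxP _ _ _ i0 xpredT (fun i : 'I_N => dotv x (nu i)) erefl.
  exists i; rewrite /top ltn_ord; apply/allP => v /(nthP 0)[j jN <-].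
  exact: (imax (Ordinal jN)).
have [i /andP[iN /allP imax] imin] := ex_minnP ex_top.
exists i; split => // j jN; case: ifPn => ji; last by apply: imax; exact: mem_nth.
rewrite ltNge; apply: contraTN ji => ij; rewrite -leqNgt.
apply: imin; rewrite /top jN; apply/allP => v /imax vi; exact: le_trans ij.
Qed.

Lemma facet_cone_inj i j x : facet_cone i x -> facet_cone j x -> i = j.
Proof.
move=> [iN hi] [jN hj]; have := hi _ jN; have := hj _ iN.
case: (ltngtP i j) => // _ h1 h2.
  by have := lt_le_trans h1 h2; rewrite ltxx.
by have := le_lt_trans h1 h2; rewrite ltxx.
Qed.

Lemma measurable_facet_cone i : measurable (facet_cone i).
Proof.
have [iN|iN] := ltnP i N; last first.
  rewrite (_ : facet_cone i = set0)//.
  by apply/seteqP; split => x // -[]; rewrite ltnNge iN.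
rewrite (_ : facet_cone i = \bigcap_(j in `I_N) [set x |
    if (j < i)%N then dotv x (nu j) < dotv x (nu i) else dotv x (nu j) <= dotv x (nu i)]).
  apply: fin_bigcap_measurable => // j _; case: (j < i)%N.
    exact: measurable_ltdotv.
  exact: measurable_ledotv.
apply/seteqP; split => x; first by move=> [_ h] j jN; exact: h.
by move=> h; split => // j jN; exact: h.
Qed.

Lemma lebesgue_rV_facet_cones (X : set 'rV[R]_m.+1) : measurable X ->
  (lebesgue_rV X = \sum_(i < N) lebesgue_rV (X `&` facet_cone i))%E.
Proof.
move=> mX; pose F i := X `&` facet_cone i.
have mF i : measurable (F i) by apply: measurableI => //; exact: measurable_facet_cone.
have tF : trivIset setT F.
  by apply/trivIsetP => i j _ _; apply: contraNeq => /set0P[x [[_ xi] [_ /(facet_cone_inj xi) ->]]].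
rewrite -(measure_bigsetU (@lebesgue_rV R m.+1) mF tF N) -bigcup_mkord.
congr (lebesgue_rV _); apply/seteqP; split => x; last by move=> [i _ []].
by move=> Xx; have [i xi] := facet_cone_cover x; have [iN _] := xi; exists i.
Qed.

Definition facet_pyramid i : set 'rV[R]_m.+1 := P `&` facet_cone i.

Definition pyramid_volume i : R := volume (facet_pyramid i).

Lemma measurable_facet_pyramid i : measurable (facet_pyramid i).
Proof.
apply: measurableI; last exact: measurable_facet_cone.
by apply: compact_measurable_rV; case: cP.
Qed.

Lemma pyramid_volumeE i : lebesgue_rV (facet_pyramid i) = (pyramid_volume i)%:E.
Proof.
have [cP' _] := cP; rewrite /pyramid_volume /volume fineK// ge0_fin_numE//.
apply: (@le_lt_trans _ _ (lebesgue_rV P)); last by rewrite volumeE// ltry.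
apply: le_measure; rewrite ?inE//; [exact: measurable_facet_pyramid|exact: compact_measurable_rV|].
exact: subIsetl.
Qed.

Lemma pyramid_volume_ge0 i : 0 <= pyramid_volume i.
Proof. exact: volume_ge0. Qed.

Lemma volume_pyramids : volume P = \sum_(i < N) pyramid_volume i.
Proof.
have [cP' _] := cP; apply: EFin_inj; rewrite -volumeE// -sumEFin.
rewrite lebesgue_rV_facet_cones; last exact: compact_measurable_rV.
by apply: eq_bigr => i _; rewrite -pyramid_volumeE.
Qed.

(** Within its facet cone, P is described by a single inequality, so that
    dilating the pyramid only moves its base. *)
Lemma facet_cone_pyramid i x (s : R) : 0 < s -> facet_cone i x ->
  dotv x (nu i) <= s -> [set s *: x | x in facet_pyramid i] x.
Proof.
move=> s0 xi xs; exists (s^-1 *: x); last by rewrite scalerKV// gt_eqF.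
split; last by apply: facet_cone_scale => //; rewrite invr_gt0.
move=> _ /(nthP 0)[j jN <-]; rewrite dotvZl ler_pdivrMl// mulr1.
exact: le_trans (facet_cone_max xi jN) xs.
Qed.

(** P + [-t v, t v] stays within the pyramids of P dilated by 1 + t |<v, nu>|. *)
Lemma seg_gain_le_pyramids v :
  seg_gain P v <= m.+1%:R * \sum_(i < N) pyramid_volume i * `|dotv v (nu i)|.
Proof.
have [cP' _] := cP.
set a := fun i => `|dotv v (nu i)|; set V := pyramid_volume.
have V0 i : 0 <= V i by exact: pyramid_volume_ge0.
have a0 i : 0 <= a i by exact: normr_ge0.
pose S := \sum_(i < N) a i.
have S0 : 0 <= S by apply: sumr_ge0.
have aS (i : 'I_N) : a i <= S by rewrite /S (bigD1 i)//= lerDl sumr_ge0.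
apply: (@ler_first_order _ _ _ (3 ^+ m.+1 * \sum_(i < N) V i * a i ^+ 2) (1 + S)^-1).
- by rewrite mulr_ge0// sumr_ge0// => i _; rewrite mulr_ge0// sqr_ge0.
- by rewrite invr_gt0; lra.
(* For t <= 1 / (1 + S) every dilation factor is within 1 of 1. *)
move=> t t0 tT.
have tS : t * (1 + S) <= 1 by rewrite -ler_pdivlMr ?mul1r//; lra.
have cX : compact_convex (sumset P (seg (t *: v))).
  by apply: compact_convex_sumset cP _; exact: compact_convex_seg.
have [cX' _] := cX.
have key : volume (sumset P (seg (t *: v))) <= \sum_(i < N) (1 + t * a i) ^+ m.+1 * V i.
  rewrite -lee_fin -volumeE// -sumEFin lebesgue_rV_facet_cones; last exact: compact_measurable_rV.
  apply: lee_sum => i _.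
  have s0 : 0 < 1 + t * a i by rewrite (@lt_le_trans _ _ 1)// lerDl mulr_ge0// ltW.
  rewrite EFinM -pyramid_volumeE -lebesgue_rV_scale_image//; last exact: measurable_facet_pyramid.
  apply: le_measure; rewrite ?inE.
  - by apply: measurableI; [exact: compact_measurable_rV|exact: measurable_facet_cone].
  - by apply: measurable_scale => //; exact: measurable_facet_pyramid.
  move=> x [/sumsetP[p [_ [Pp [s s1 <-] ->]]] xi].
  apply: facet_cone_pyramid => //; rewrite dotvDl lerD//.
    by apply: Pp; exact: mem_nth.
  rewrite !dotvZl (le_trans (ler_norm _))// !normrM (gtr0_norm t0) mulrCA ler_wpM2l ?(ltW t0)//.
  by rewrite ler_piMl// ler_norml; move: s1; rewrite /= in_itv.
rewrite mulrC -seg_gainZ ?(ltW t0)// /seg_gain volume_pyramids.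
rewrite lerBlDr; apply: (le_trans key).
rewrite !big_distrr/= !big_distrl/= -!big_split/=; apply: ler_sum => i _.
have ht : -1 <= t * a i <= 1.
  have : 0 <= t * a i by rewrite mulr_ge0// ltW.
  by have := aS i; nra.
apply: (le_trans (ler_wpM2r (V0 i) (exprD1_le_quadratic m.+1 ht))).
by rewrite le_eqVlt; apply/orP; left; apply/eqP; rewrite /a /V; ring.
Qed.

(** The points of P that leave P when translated by t v cover what remains of
    each pyramid with <v, nu> > 0 once it is shrunk by 1 - t <v, nu>. *)
Lemma pyramids_le_seg_gain_pos v :
  m.+1%:R * (\sum_(i < N) pyramid_volume i * Num.max 0 (dotv v (nu i))) <=
  seg_gain P v / 2.
Proof.
have [cP' vP] := cP.
set b := fun i => Num.max 0 (dotv v (nu i)); set V := pyramid_volume.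
have V0 i : 0 <= V i by exact: pyramid_volume_ge0.
have b0 i : 0 <= b i by rewrite /b le_max lexx.
have bv i : dotv v (nu i) <= b i by rewrite /b le_max lexx orbT.
pose S := \sum_(i < N) b i.
have S0 : 0 <= S by apply: sumr_ge0.
have bS (i : 'I_N) : b i <= S by rewrite /S (bigD1 i)//= lerDl sumr_ge0.
apply: (@ler_first_order _ _ _ (3 ^+ m.+1 * \sum_(i < N) V i * b i ^+ 2) (1 + S)^-1).
- by rewrite mulr_ge0// sumr_ge0// => i _; rewrite mulr_ge0// sqr_ge0.
- by rewrite invr_gt0; lra.
(* For t <= 1 / (1 + S) every dilation factor is within 1 of 1. *)
move=> t t0 tT.
have tS : t * (1 + S) <= 1 by rewrite -ler_pdivlMr ?mul1r//; lra.
have t0' := ltW t0.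
have tb (i : 'I_N) : 0 <= t * b i < 1.
  by rewrite mulr_ge0//=; have := bS i; nra.
pose w := t *: v.
pose Y := P `&` ~` ((fun x => x + w) @^-1` P).
have mP := compact_measurable_rV cP'.
have mY : measurable Y.
  apply: measurableI => //; apply: measurableC.
  by apply: measurable_preimage mP; exact: measurable_rV_addr.
(* Y + w is disjoint from P and both lie in P + [0, w]. *)
have YQ : (lebesgue_rV Y <= (seg_gain P w / 2)%:E)%E.
  have cQ := compact_convex_sumset cP (compact_convex_ray w); have [cQ' _] := cQ.
  pose Yw := (fun x => x + - w) @^-1` Y.
  have mYw : measurable Yw by apply: measurable_preimage mY; exact: measurable_rV_addr.
  have h : (lebesgue_rV P + lebesgue_rV Yw <= lebesgue_rV (sumset P (ray w)))%E.
    rewrite -measureU//; last first.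
      by apply/seteqP; split => x // -[Px [_]] /=; rewrite subrK.
    apply: le_measure; rewrite ?inE.
    - exact: measurableU.
    - exact: compact_measurable_rV.
    move=> x [Px|[Px _]].
      apply/sumsetP; exists x, 0; rewrite addr0; split => //.
      by exists 0; rewrite ?scale0r//= in_itv/= lexx ler01.
    apply/sumsetP; exists (x - w), w; rewrite subrK; split => //.
    by exists 1; rewrite ?scale1r//= in_itv/= lexx ler01.
  rewrite -(lebesgue_rV_translate (- w) mY) -/Yw.
  move: h; rewrite (volumeE cP') (volumeE cQ') volume_sumset_ray_gain// EFinD.
  by rewrite leeD2lE.
have key : \sum_(i < N) (V i - (1 - t * b i) ^+ m.+1 * V i) <= seg_gain P w / 2.
  rewrite -lee_fin; apply: le_trans YQ; rewrite (lebesgue_rV_facet_cones mY) -sumEFin.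
  apply: lee_sum => i _; have /andP[tb0 tb1] := tb i.
  have s0 : 0 < 1 - t * b i by rewrite subr_gt0.
  rewrite EFinB leeBlDr// EFinM -!pyramid_volumeE -lebesgue_rV_scale_image//; last exact: measurable_facet_pyramid.
  have mYi : measurable (Y `&` facet_cone i).
    by apply: measurableI mY _; exact: measurable_facet_cone.
  have mSi := measurable_scale s0 (measurable_facet_pyramid i).
  apply: (@le_trans _ _ (lebesgue_rV ((Y `&` facet_cone i) `|`
     [set (1 - t * b i) *: x | x in facet_pyramid i]))); last exact: measureU2.
  apply: le_measure; rewrite ?inE.
  - exact: measurable_facet_pyramid.
  - exact: measurableU.
  move=> x [Px xi]; have [Pxw|Pxw] := pselect (P (x + w)); last by left.
  right; apply: facet_cone_pyramid => //.
  have iN : (i < N)%N by [].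
  have := Pxw _ (mem_nth 0 iN); rewrite dotvDl dotvZl => h1.
  have [bi0|bi0] := leP (dotv v (nu i)) 0.
    have -> : b i = 0 by rewrite /b; apply/max_idPl.
    by rewrite mulr0 subr0; apply: Px; exact: mem_nth.
  have -> : b i = dotv v (nu i) by rewrite /b; apply/max_idPr; exact: ltW.
  by lra.
rewrite [X in _ <= X + _]mulrAC [X in _ <= X / _ + _]mulrC -seg_gainZ// -/w.
rewrite -lerBlDr; apply: le_trans key.
rewrite !big_distrr/= !big_distrl/= -sumrB; apply: ler_sum => i _.
have /andP[tb0 tb1] := tb i.
have ht : -1 <= - (t * b i) <= 1 by apply/andP; split; lra.
have := ler_wpM2r (V0 i) (exprD1_le_quadratic m.+1 ht) => h.
apply: (@le_trans _ _ (V i - (1 + m.+1%:R * - (t * b i) + 3 ^+ m.+1 * (- (t * b i)) ^+ 2) * V i)).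
  by rewrite le_eqVlt; apply/orP; left; apply/eqP; rewrite /b /V; ring.
by rewrite lerD2l lerN2.
Qed.

Lemma segN v : seg (- v) = seg v :> set 'rV[R]_m.+1.
Proof.
apply/seteqP; split => x [s s1 <-]; exists (- s); rewrite ?scaleNr ?scalerN ?opprK//;
by move: s1; rewrite /= !in_itv/= => /andP[? ?]; apply/andP; split; lra.
Qed.

(** Cauchy's projection formula, the facets entering through the volumes of
    the pyramids over them.  The lower bounds obtained for v and for - v add up
    to the upper bound. *)
Theorem cauchy_polytope v :
  seg_gain P v = m.+1%:R * \sum_(i < N) pyramid_volume i * `|dotv v (nu i)|.
Proof.
apply/eqP; rewrite eq_le seg_gain_le_pyramids/=.
have h1 := pyramids_le_seg_gain_pos v; have h2 := pyramids_le_seg_gain_pos (- v).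
have gN : seg_gain P (- v) = seg_gain P v by rewrite /seg_gain segN.
rewrite gN in h2.
rewrite (eq_bigr (fun i : 'I_N => pyramid_volume i * Num.max 0 (dotv v (nu i)) +
  pyramid_volume i * Num.max 0 (dotv (- v) (nu i)))).
  by rewrite big_split/= mulrDr; lra.
move=> i _; rewrite -mulrDr dotvNl; congr (_ * _).
have [h|h] := leP 0 (dotv v (nu i)).
  by rewrite ger0_norm// (max_idPl _) ?addr0// oppr_le0.
by rewrite ltr0_norm// add0r; apply/esym/max_idPr; rewrite oppr_ge0 ltW.
Qed.

End cauchy_formula.

(** * Projection bodies are limits of zonotopes *)

Lemma zonotope_support_attained (R : realType) (n : nat) (us : seq 'rV[R]_n)
    (y : 'rV[R]_n) :
  exists2 z, zonotope us z & dotv z y = \sum_(u <- us) `|dotv u y|.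
Proof.
elim: us => [|u us [z zus zE]]; first by exists 0; rewrite ?big_nil ?dotv0l.
exists (Num.sg (dotv u y) *: u + z).
  apply/sumsetP; exists (Num.sg (dotv u y) *: u), z; split => //.
  by exists (Num.sg (dotv u y)) => //; rewrite /= in_itv/= -ler_norml normr_sg lern1 leq_b1.
by rewrite big_cons dotvDl dotvZl zE -normrEsg.
Qed.

Lemma cube_in_interior (R : realType) (n : nat) (K : set 'rV[R]_n) : K° !=set0 ->
  exists x0 : 'rV[R]_n, exists2 r : R, 0 < r & forall v, cube n r v -> K (x0 + v).
Proof.
move=> [x0 /nbhs_ballP[e /= e0 eK]]; exists x0, (e / 2); first by rewrite divr_gt0.
move=> v /cubeP vr; apply: eK; split => // i j; rewrite (ord1 i) /ball /=.
rewrite mxE opprD addrA subrr add0r normrN; apply: (le_lt_trans (vr j)).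
by rewrite ltr_pdivrMr//; lra.
Qed.

Lemma sym_convex_body_cube (R : realType) (n : nat) (K : set 'rV[R]_n) :
  sym_convex_body K -> exists2 r : R, 0 < r & cube n r `<=` K.
Proof.
move=> [[_ /convex_setP vK K0] Ksym]; have [x0 [r r0 rK]] := cube_in_interior K0.
exists r => // v vr.
have vr' : cube n r (- v).
  by move: vr => /cubeP vr; apply/cubeP => i; rewrite mxE normrN.
have h2 : K (v - x0).
  by rewrite Ksym; exists (x0 + - v); [exact: rK|rewrite opprD opprK addrC].
have := vK _ _ 2^-1 (rK _ vr) h2.
have -> : 2^-1 *: (x0 + v) + (1 - 2^-1) *: (v - x0) = v.
  by apply/rowP => i; rewrite !mxE; field.
by apply; apply/andP; split; lra.
Qed.

Lemma le_support_function (R : realType) (n : nat) (D : set 'rV[R]_n) (x y : 'rV[R]_n) :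
  compact D -> D y -> dotv y x <= support_function D x.
Proof.
move=> cD Dy; rewrite /support_function; apply: ub_le_sup; last by exists y; rewrite 1?dotvC.
have cI : compact [set dotv x z | z in D].
  apply: continuous_compact cD; apply: continuous_subspaceT.
  by under eq_fun do rewrite dotvC; exact: dotvr_continuous.
by have [] := compact_has_sup (ex_intro _ _ (ex_intro2 _ _ y Dy erefl)) cI.
Qed.

(** Let D be the projection body of L.  Up to a translation L contains 0 in its
    interior and lies in a polytope P contained in (1 + d) L, whose projection
    body is a zonotope by Cauchy's formula; inclusions of convex bodies can be
    read on their support functions. *)
Theorem projection_body_zonotope (R : realType) (m : nat) (D : set 'rV[R]_m.+1) (d : R) :
  projection_body D -> 0 < d ->
  exists us, D `<=` zonotope us /\
    zonotope us `<=` [set (1 + d) ^+ m *: x | x in D].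
Proof.
move=> [L [cL vL L0] [[[cD vD D0] Dsym] hD]] d0.
have [x0 [r r0 rL]] := cube_in_interior L0.
have ccD : compact_convex D by split.
have ccL : compact_convex L by split.
pose L1 := [set x + - x0 | x in L].
have ccL1 : compact_convex L1 by exact: compact_convex_translate.
have rL1 : cube m.+1 r `<=` L1.
  by move=> v /rL Lv; exists (x0 + v) => //; rewrite addrAC subrr add0r.
have [nus [nus0 L1P PL1]] := polytope_approx ccL1 r0 rL1 d0.
have ccdL1 := compact_convex_scale (1 + d) ccL1.
have cP := compact_convex_polytope ccdL1.1 PL1.
have d1 : 0 < 1 + d by lra.
pose us := [seq (m.+1%:R * pyramid_volume nus i / 2) *: nth 0 nus i | i <- iota 0 (size nus)].
have usE v : \sum_(u <- us) `|dotv u v| = seg_gain (polytope nus) v / 2.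
  rewrite big_map cauchy_polytope// big_distrr/= big_distrl/= -(big_mkord xpredT
    (fun i => m.+1%:R * (pyramid_volume nus i * `|dotv v (nth 0 nus i)|) / 2)).
  rewrite /index_iota subn0; apply: eq_bigr => i _.
  rewrite dotvZl normrM ger0_norm; last by rewrite divr_ge0// mulr_ge0// pyramid_volume_ge0.
  by rewrite dotvC; ring.
have polar v xi : sphere xi -> v = enorm v *: xi ->
    \sum_(u <- us) `|dotv u v| = enorm v * projection_function (polytope nus) xi.
  move=> xi1 vE; rewrite usE [in LHS]vE seg_gain_sphere ?enorm_ge0//.
  by field.
have PP xi : sphere xi -> support_function D xi <= projection_function (polytope nus) xi.
  move=> xi1; rewrite hD// -(projection_function_translate (- x0) xi1 ccL).
  exact: projection_functionS.
have PP' xi : sphere xi ->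
    projection_function (polytope nus) xi <= (1 + d) ^+ m * support_function D xi.
  move=> xi1; rewrite hD// -(projection_function_translate (- x0) xi1 ccL).
  by rewrite -projection_function_scale//; exact: projection_functionS.
exists us; split => [x Dx|z zus].
  apply: contrapT => xus.
  have [nu [c [nuZ cx]]] := separation (compact_convex_zonotope us)
    (ex_intro _ 0 (zonotope0 us)) xus.
  have [xi xi1 nuE] := polar_decomposition nu.
  have [z zus zE] := zonotope_support_attained us nu.
  have := nuZ _ zus; rewrite zE (polar _ _ xi1 nuE) => h.
  have : dotv x nu <= enorm nu * projection_function (polytope nus) xi.
    rewrite [in leLHS]nuE dotvZr ler_wpM2l ?enorm_ge0//.
    exact: le_trans (le_support_function _ cD Dx) (PP _ xi1).
  by lra.
apply: contrapT => zD.
have k0 : 0 < (1 + d) ^+ m by rewrite exprn_gt0.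
have [y0 Dy0] : D !=set0 by case: D0 => y /interior_subset Dy; exists y.
have [nu [c [nuD cz]]] := separation (compact_convex_scale ((1 + d) ^+ m) ccD)
  (ex_intro _ _ (ex_intro2 _ _ y0 Dy0 erefl)) zD.
have [xi xi1 nuE] := polar_decomposition nu.
have := dotv_zonotope nu zus; rewrite (polar _ _ xi1 nuE) => h.
have e0 := enorm_ge0 nu.
have h2 : enorm nu * projection_function (polytope nus) xi <=
    enorm nu * ((1 + d) ^+ m * support_function D xi).
  by rewrite ler_wpM2l//; exact: PP'.
have nu0 : 0 < enorm nu.
  rewrite lt_def e0 andbT; apply: contraTneq isT => e00; exfalso.
  have nu0 : nu = 0 by rewrite nuE e00 scale0r.
  have : c < 0 by move: cz; rewrite nu0 dotv0r.
  by have := nuD _ (ex_intro2 _ _ y0 Dy0 erefl); rewrite nu0 dotv0r; lra.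
have h3 : support_function D xi <= c / (enorm nu * (1 + d) ^+ m).
  apply: ge_sup; first by exists (dotv xi y0); exists y0.
  move=> _ [y Dy <-]; rewrite ler_pdivlMr ?mulr_gt0//.
  have := nuD _ (ex_intro2 _ _ y Dy erefl).
  by rewrite dotvZl [in dotv y nu]nuE dotvZr dotvC; lra.
move: h3; rewrite ler_pdivlMr ?mulr_gt0// => h3.
have := lt_le_trans cz (le_trans h h2).
by rewrite ltNge mulrA mulrC h3.
Qed.

(** * Isotropic bodies inside zonotopes *)

Lemma continuous_normr (R : realType) (T : topologicalType) (f : T -> R) :
  continuous f -> continuous (fun x => `|f x|).
Proof. by move=> cf x; apply: cvg_norm; exact: cf. Qed.

Section isotropy.
Variables (R : realType) (m : nat) (D : set 'rV[R]_m.+1) (L : R).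
Hypotheses (cD : compact_convex D) (volD : lebesgue_rV D = 1%E) (L0 : 0 < L).
Hypothesis isoD : forall xi : 'rV[R]_m.+1, sphere xi ->
  (\int[@lebesgue_rV R m.+1]_(x in D) (dotv x xi ^+ 2)%:E = (L ^+ 2)%:E)%E.

Local Notation mu := (@lebesgue_rV R m.+1).

Let mD : measurable D.
Proof. by apply: compact_measurable_rV; case: cD. Qed.

Let msq (w : 'rV[R]_m.+1) : measurable_fun D (fun x => (dotv x w ^+ 2)%:E).
Proof.
apply/measurable_EFinP; apply: measurable_funTS.
by apply: measurable_funX; exact: measurable_fun_dotv.
Qed.

Lemma isotropic_second_moment (w : 'rV[R]_m.+1) :
  (\int[mu]_(x in D) (dotv x w ^+ 2)%:E = (L ^+ 2 * dotv w w)%:E)%E.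
Proof.
have [xi xi1 wE] := polar_decomposition w.
rewrite (eq_integral (fun x => (enorm w ^+ 2)%:E * (dotv x xi ^+ 2)%:E)%E); last first.
  by move=> x _; rewrite [in LHS]wE dotvZr exprMn EFinM.
rewrite ge0_integralZl//; first last.
- by rewrite lee_fin sqr_ge0.
- by move=> x _; rewrite lee_fin sqr_ge0.
by rewrite isoD// -EFinM sqr_enorm mulrC.
Qed.

(** The expectation of |P X|^2, for X uniform in D and P the orthogonal
    projection of rank k with frame C, is k L^2; as X lies in Z it is at most
    that of the sum of the |<P u, X>|, each of mean at most L |P u|. *)
Lemma isotropic_zonotope_frames (us : seq 'rV[R]_m.+1) : D `<=` zonotope us ->
  forall k (C : 'M[R]_(k, m.+1)), C *m C^T = 1%:M ->
    L * k%:R <= \sum_(u <- us) enorm (u *m C^T).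
Proof.
move=> DZ k C CC.
pose w (u : 'rV[R]_m.+1) := u *m C^T *m C.
(* This value of a u makes the two terms of g u have the same mean. *)
pose a u := L * enorm (w u).
have ew u : enorm (w u) = enorm (u *m C^T).
  by rewrite /enorm /w dotv_mulmx -[_ *m C *m _]mulmxA CC mulmx1.
have a0 u : 0 <= a u by rewrite mulr_ge0// ?enorm_ge0// ltW.
pose g u x := 2^-1 * ((a u)^-1 * dotv x (w u) ^+ 2 + a u).
have amgm u x : `|dotv u (x *m C^T *m C)| <= g u x.
  have -> : dotv u (x *m C^T *m C) = dotv x (w u).
    by rewrite dotvC !dotv_mulmx trmxK /w.
  rewrite /g -[dotv x (w u) ^+ 2]real_normK ?num_real//; set z := `|_|.
  have z0 : 0 <= z by exact: normr_ge0.
  have [au0|au0] := eqVneq (a u) 0.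
    have w0 : w u = 0.
      apply/eqP; rewrite -dotv_eq0 -sqr_enorm expf_eq0/=.
      by move/eqP: au0; rewrite mulf_eq0 gt_eqF.
    by rewrite /z w0 dotv0r normr0 au0 invr0; lra.
  have au0' : 0 < a u by rewrite lt_def au0 a0.
  rewrite -(ler_pM2l au0') mulrCA mulrDr mulVKf//.
  have := sqr_ge0 (z - a u); nra.
have frame x : \sum_(i < k) dotv x (row i C) ^+ 2 = dotv x (x *m C^T *m C).
  rewrite -[C in _ *m C]trmxK -dotv_mulmx dotvE; apply: eq_bigr => i _.
  have -> : (x *m C^T) ord0 i = dotv x (row i C).
    rewrite dotvE !mxE; apply: eq_bigr => j _; by rewrite !mxE.
  by rewrite expr2.
have rowC i : dotv (row i C) (row i C) = 1.
  have /matrixP/(_ i i) := CC; rewrite !mxE eqxx mulr1n => <-.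
  by rewrite dotvE; apply: eq_bigr => j _; rewrite !mxE.
have g0 u x : 0 <= g u x.
  by rewrite /g mulr_ge0// addr_ge0// mulr_ge0 ?invr_ge0// sqr_ge0.
have mg u : measurable_fun D (fun x => (g u x)%:E).
  apply/measurable_EFinP; apply: measurable_funTS; rewrite /g.
  apply: measurable_funM; first exact: measurable_cst.
  apply: measurable_funD; last exact: measurable_cst.
  apply: measurable_funM; first exact: measurable_cst.
  by apply: measurable_funX; exact: measurable_fun_dotv.
have intg u : (\int[mu]_(x in D) (g u x)%:E = (a u)%:E)%E.
  rewrite (eq_integral (fun x => 2^-1%:E *
    ((a u)^-1%:E * (dotv x (w u) ^+ 2)%:E + (a u)%:E))%E); last by move=> x _; rewrite /g EFinM EFinD EFinM.
  have aV0 : 0 <= (a u)^-1 by rewrite invr_ge0.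
  have m1 : measurable_fun D (fun x => (a u)^-1%:E * (dotv x (w u) ^+ 2)%:E)%E.
    by apply: emeasurable_funM; [exact: measurable_cst|exact: msq].
  have p1 x : D x -> (0 <= (a u)^-1%:E * (dotv x (w u) ^+ 2)%:E)%E.
    by move=> _; rewrite -EFinM lee_fin mulr_ge0// sqr_ge0.
  rewrite ge0_integralZl//; first last.
  - by move=> x Dx; rewrite adde_ge0 ?p1// lee_fin.
  - by apply: emeasurable_funD => //; exact: measurable_cst.
  rewrite ge0_integralD//; first last.
  - by move=> x _; rewrite lee_fin.
  rewrite ge0_integralZl//; first last.
  - by move=> x _; rewrite lee_fin sqr_ge0.
  have -> : (\int[mu]_(x in D) (a u)%:E = (a u)%:E)%E.
    transitivity ((a u)%:E * lebesgue_rV D)%E; last by rewrite volD mule1.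
    exact: integral_cst.
  rewrite isotropic_second_moment.
  rewrite -[LHS]/((2^-1 * ((a u)^-1 * (L ^+ 2 * dotv (w u) (w u)) + a u))%:E).
  congr EFin; rewrite -sqr_enorm.
  have -> : L ^+ 2 * enorm (w u) ^+ 2 = a u ^+ 2 by rewrite /a exprMn.
  have [->|au0] := eqVneq (a u) 0; first by rewrite invr0 mul0r addr0 mulr0.
  by field.
have : (\int[mu]_(x in D) (\sum_(i < k) (dotv x (row i C) ^+ 2)%:E) <=
        \int[mu]_(x in D) (\sum_(u <- us) (g u x)%:E))%E.
  apply: ge0_le_integral => //.
  - by move=> x _; rewrite sume_ge0// => i _; rewrite lee_fin sqr_ge0.
  - by apply: emeasurable_sum => i; exact: msq.
  - by apply: emeasurable_sum => u; exact: mg.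
  move=> x Dx; rewrite !sumEFin lee_fin frame.
  apply: (le_trans (dotv_zonotope _ (DZ _ Dx))).
  by apply: ler_sum => u _; exact: amgm.
rewrite !ge0_integral_sum//; first last.
- by move=> i x _; rewrite lee_fin sqr_ge0.
- by move=> u x _; rewrite lee_fin.
rewrite (eq_bigr (fun=> (L ^+ 2)%:E)); last by move=> i _; rewrite isoD.
rewrite (eq_bigr (fun u => (a u)%:E)) => [|u _]; last exact: intg.
rewrite !sumEFin lee_fin sumr_const card_ord -[leLHS]mulr_natr expr2 -mulrA.
rewrite /a -big_distrr/= ler_pM2l// => h; apply: (le_trans h).
by apply: ler_sum => u _; rewrite ew.
Qed.

(** If the shadow along xi were small, the slab |<x, xi>| <= 2 would contain
    at most 2/3 of D, and the second moment would exceed 1. *)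
Lemma isotropic_shadow_ge (xi : 'rV[R]_m.+1) : sphere xi -> L <= 1 ->
  6^-1 <= projection_function D xi.
Proof.
move=> xi1 L1; rewrite leNgt; apply/negP; set p := projection_function D xi => p6.
have p0 : 0 <= p by exact: projection_function_ge0.
have := perp_basisP xi1; have pE : p = volume (shadow D xi) by rewrite -projection_functionE.
have cS := compact_convex_shadow xi cD; rewrite /shadow in pE cS.
move: (perp_basis xi : 'M[R]_(m, m.+1)) pE cS => W pE [cS _] xiW.
pose slab : set 'rV[R]_m.+1 := [set x | `|dotv x xi| <= 2].
have mslab : measurable slab.
  apply: closed_measurable_rV; apply: (@closed_le_rV _ _ (fun x => `|dotv x xi|)).
  by apply: continuous_normr; exact: dotvr_continuous.
have mDs : measurable (D `&` slab) by exact: measurableI.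
have mDc : measurable (D `\` slab) by exact: measurableD.
have small : (mu (D `&` slab) <= (4 * p)%:E)%E.
  pose I2 : set (measurableTypeR R) := `[-2, 2]%classic.
  have mI2 : measurable I2 by exact: measurable_itv.
  rewrite (lebesgue_rV_slices xi1 xiW mDs).
  apply: (@le_trans _ _ (\int[@lebesgue_measure R]_(s in I2) p%:E)%E).
    rewrite [leRHS]integral_mkcond; apply: ge0_le_integral => //.
    - exact: measurable_fun_slice.
    - by apply/measurable_restrict => //; exact: measurable_cst.
    move=> s _; rewrite patchE; case: ifPn => [sin|sout].
      rewrite pE -volumeE//; apply: le_measure; rewrite ?inE.
      - exact: measurable_slice.
      - exact: compact_measurable_rV.
      by move=> y [Dy _]; exact: (@slice_sub_shadow R m xi W xiW D s y Dy).
    rewrite (_ : [set y | _] = set0) ?measure0//; apply/seteqP; split => y // -[_].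
    rewrite /slab/= frame_dot// => s2; move/negP: sout; apply.
    by apply/mem_set; rewrite /I2 /= in_itv/= -ler_norml.
  rewrite integral_cst//= lebesgue_measure_itv/= lte_fin ifT; last by lra.
  by rewrite -EFinB -EFinM lee_fin; lra.
have split_D : (1%:E = mu (D `&` slab) + mu (D `\` slab))%E.
  by rewrite -volD addeC; exact: (measureDI (@lebesgue_rV R m.+1)).
have fin1 : mu (D `&` slab) \is a fin_num.
  by rewrite ge0_fin_numE// (le_lt_trans small)// ltry.
have big : ((1 - 4 * p)%:E <= mu (D `\` slab))%E.
  by rewrite EFinB leeBlDr// split_D addeC leeD2l.
have : ((4 * (1 - 4 * p))%:E <= (L ^+ 2)%:E)%E.
  rewrite -(isoD xi1) EFinM.
  apply: (@le_trans _ _ (4%:E * mu (D `\` slab))%E); first by rewrite lee_pmul2l.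
  have -> : (4%:E * mu (D `\` slab) = \int[mu]_(x in D `\` slab) 4%:E)%E.
    by apply/esym; exact: (integral_cst (@lebesgue_rV R m.+1)).
  apply: (@le_trans _ _ (\int[mu]_(x in D `\` slab) (dotv x xi ^+ 2)%:E)%E).
    apply: ge0_le_integral => //.
    - by apply: measurable_funS (msq xi) => // x [].
    move=> x [_ xs]; rewrite lee_fin -[_ ^+ 2]real_normK ?num_real//.
    have {xs} : 2 < `|dotv x xi| by rewrite ltNge; apply/negP.
    by set z := `|_| => z2; nra.
  apply: ge0_subset_integral => //; by [exact: subDsetl|move=> x _; rewrite lee_fin sqr_ge0].
rewrite lee_fin => h; have : L ^+ 2 <= 1 by rewrite expr_le1// ltW.
lra.
Qed.

End isotropy.

(** * Dependence of the projections on the direction *)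

Lemma continuous_ball (R : realType) (V : pseudoMetricType R) (f : V -> R) :
  (forall v (e : R), 0 < e ->
    exists2 d : R, 0 < d & forall u, ball v d u -> `|f v - f u| <= e) ->
  continuous f.
Proof.
move=> fe v; apply/cvgrPdist_le => e e0; have [d d0 fd] := fe v e e0.
by apply/nbhs_ballP; exists d.
Qed.

(** Moving v by a small vector enlarges K + [-v, v] by a factor close to 1. *)
Lemma volume_sumset_seg_near (R : realType) (n : nat) (K : set 'rV[R]_n)
    (r e : R) (u v : 'rV[R]_n) :
  compact_convex K -> 0 < r -> cube n r `<=` K -> 0 < e -> cube n (e * r) (v - u) ->
  volume (sumset K (seg v)) <= (1 + e) ^+ n * volume (sumset K (seg u)).
Proof.
move=> cK r0 rK e0 /cubeP uv.
have cX := compact_convex_sumset cK (compact_convex_seg u).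
have e1 : 0 < 1 + e by lra.
rewrite -volume_scale//; last by case: cX.
apply: volumeS.
- by have [] := compact_convex_sumset cK (compact_convex_seg v).
- by have [] := compact_convex_scale (1 + e) cX.
have [_ vX] := cX.
rewrite -sumset_scale_convex ?ltW// => _ /sumsetP[x [_ [Kx [s s1 <-] ->]]].
apply/sumsetP; exists (x + s *: u), (s *: (v - u)); split.
- by apply/sumsetP; exists x, (s *: u); split => //; exists s.
- exists (e^-1 *: (s *: (v - u))); last by rewrite scalerKV// gt_eqF.
  apply: sub_sumset; first exact: seg0.
  apply: rK; apply/cubeP => i; have := uv i; rewrite !mxE => h.
  rewrite !normrM gtr0_norm ?invr_gt0// ler_pdivrMl//; apply: le_trans h.
  by rewrite ler_piMl// ler_norml; move: s1; rewrite /= in_itv.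
- by apply/rowP => i; rewrite !mxE; ring.
Qed.

Lemma continuous_seg_gain (R : realType) (m : nat) (K : set 'rV[R]_m.+1) (r : R) :
  compact_convex K -> 0 < r -> cube m.+1 r `<=` K -> continuous (fun v => seg_gain K v).
Proof.
move=> cK r0 rK; apply: continuous_ball => v e e0.
set V := fun u => volume (sumset K (seg u)).
have V0 u : 0 <= V u by exact: volume_ge0.
pose a := Num.min 1 (e / (2 * V v + 1)).
have Vv1 : 0 < 2 * V v + 1 by have := V0 v; lra.
have a0 : 0 < a by rewrite lt_min ltr01 divr_gt0.
have a1 : a <= 1 by rewrite ge_min lexx.
have aV : a * (2 * V v + 1) <= e by rewrite -ler_pdivlMr ?ge_min ?lexx ?orbT.
have [d d0 hd] := exprD1_small m.+1 a0.
have dr0 : 0 < d * r by rewrite mulr_gt0.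
exists (d * r) => // u [_ vu].
have uv : cube m.+1 (d * r) (v - u).
  by apply/cubeP => i; rewrite !mxE; exact: ltW (vu ord0 i).
have uv' : cube m.+1 (d * r) (u - v).
  by apply/cubeP => i; rewrite !mxE distrC; exact: ltW (vu ord0 i).
have h1 := volume_sumset_seg_near cK r0 rK d0 uv.
have h2 := volume_sumset_seg_near cK r0 rK d0 uv'.
rewrite /seg_gain opprB addrA subrK -/(V u) -/(V v).
have {}h1 : V v <= (1 + a) * V u by exact: le_trans h1 (ler_wpM2r (V0 u) hd).
have {}h2 : V u <= (1 + a) * V v by exact: le_trans h2 (ler_wpM2r (V0 v) hd).
have := V0 u; have := V0 v => v0 u0.
rewrite ler_norml; apply/andP; split; nra.
Qed.

Lemma compact_sphere (R : realType) (n : nat) : compact (@sphere R n).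
Proof.
apply: subclosed_compact (@compact_cube R n 1) _; last first.
  move=> x x1; apply/cubeP => i.
  rewrite -ler_sqr ?nnegrE// real_normK ?num_real// expr1n.
  by rewrite -x1; exact: sqr_coord_le_dotv.
rewrite (_ : @sphere R n = (fun x => dotv x x) @^-1` [set 1])//.
by apply: closed_comp => [x _|]; [exact: sqdotv_continuous|exact: closed_eq].
Qed.

Lemma max_projection_difference (R : realType) (m : nat) (K D : set 'rV[R]_m.+1) (r s : R) :
  compact_convex K -> 0 < r -> cube m.+1 r `<=` K ->
  compact_convex D -> 0 < s -> cube m.+1 s `<=` D ->
  exists M : R, is_max [set projection_function K xi - projection_function D xi
     | xi in @sphere R m.+1] M.
Proof.
move=> cK r0 rK cD s0 sD.
pose F (v : 'rV[R]_m.+1) := seg_gain K v - seg_gain D v.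
have cF : continuous F.
  have h1 := continuous_seg_gain cK r0 rK; have h2 := continuous_seg_gain cD s0 sD.
  by move=> x; apply: continuousB; [exact: h1|exact: h2].
have FE xi : sphere xi -> F xi = 2 * (projection_function K xi - projection_function D xi).
  move=> xi1; rewrite /F -[xi in LHS]scale1r !seg_gain_sphere//; ring.
have [xi0 xi01 _] := polar_decomposition (0 : 'rV[R]_m.+1).
have [xi /set_mem xi1 ximax] := compact_EVT_max (ex_intro _ _ xi01)
  (@compact_sphere R m.+1) (continuous_subspaceT cF).
exists (projection_function K xi - projection_function D xi); split; first by exists xi.
move=> _ [v v1 <-]; have := ximax _ (mem_set v1); rewrite !FE//; lra.
Qed.

Lemma volume_cube_gt0 (R : realType) (n : nat) (K : set 'rV[R]_n) (r : R) :
  compact K -> 0 < r -> cube n r `<=` K -> 0 < volume K.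
Proof.
move=> cK r0 rK; apply: (@lt_le_trans _ _ (volume (cube n r))).
  by rewrite /volume lebesgue_rV_cube ?ltW//= exprn_gt0// addr_gt0.
by apply: volumeS => //; exact: compact_cube.
Qed.

(** * Stability for projection bodies *)

Lemma powR_root (R : realType) (m : nat) (x : R) : 0 < x ->
  exists2 a : R, 0 < a & x = a ^+ m.+1 /\ x `^ (m%:R / m.+1%:R) = a ^+ m.
Proof.
move=> x0; exists (x `^ m.+1%:R^-1); first exact: powR_gt0.
split; rewrite -powR_mulrn ?powR_ge0// -powRrM.
  by rewrite mulVf ?pnatr_eq0// powRr1// ltW.
by rewrite mulrC.
Qed.

(** Let d tend to 0 in the comparison of K with a zonotope that lies between D
    and (1 + d)^m D. *)
Theorem shephard_projection_body (R : realType) (m : nat) (D K : set 'rV[R]_m.+1)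
    (r a b lam : R) :
  projection_body D -> compact_convex K -> 0 < r -> cube m.+1 r `<=` K ->
  0 < a -> 0 < b -> 0 <= lam -> volume K = a ^+ m.+1 -> volume D = b ^+ m.+1 ->
  (forall xi, sphere xi -> projection_function K xi <= lam * projection_function D xi) ->
  a ^+ m <= lam * b ^+ m.
Proof.
move=> pD cK r0 rK a0 b0 lam0 Ka Db KD.
have cD : compact_convex D by case: pD => L _ [[[? ? _] _] _]; split.
have bm0 : 0 < b ^+ m by rewrite exprn_gt0.
have lb0 : 0 <= lam * b ^+ m by rewrite mulr_ge0// ltW.
apply/ler_addgt0Pr => e e0.
have e1 : 0 < e / (lam * b ^+ m + 1) by rewrite divr_gt0//; lra.
have [d d0 hd] := exprD1_small (m * m) e1.
have [us [DZ ZD]] := projection_body_zonotope pD d0.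
have cZ := compact_convex_zonotope us.
have k0 : 0 < (1 + d) ^+ m by rewrite exprn_gt0//; lra.
have ckD := compact_convex_scale ((1 + d) ^+ m) cD.
have vZ1 : volume D <= volume (zonotope us).
  by apply: volumeS => //; [case: cD|case: cZ].
have vZ2 : volume (zonotope us) <= ((1 + d) ^+ m * b) ^+ m.+1.
  rewrite exprMn -Db -volume_scale//; last by case: cD.
  by apply: volumeS => //; [case: cZ|case: ckD].
have Z0 : 0 < volume (zonotope us) by rewrite (lt_le_trans _ vZ1)// Db exprn_gt0.
have [z z0 [Zz _]] := powR_root m Z0.
have zb : z <= (1 + d) ^+ m * b.
  rewrite -(@ler_pXn2r _ m.+1) ?nnegrE// -?Zz//; first exact: ltW.
  by rewrite mulr_ge0// ltW.
have KZ xi : sphere xi ->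
    projection_function K xi <= lam * projection_function (zonotope us) xi.
  move=> xi1; apply: (le_trans (KD _ xi1)); rewrite ler_wpM2l//.
  exact: projection_functionS.
have h := shephard_zonotope cK r0 rK a0 z0 lam0 Ka Zz KZ.
apply: (le_trans h).
have zm : z ^+ m <= (1 + d) ^+ (m * m) * b ^+ m.
  by rewrite exprM -exprMn; apply: lerXn2r; rewrite ?nnegrE ?mulr_ge0// ltW.
apply: (@le_trans _ _ (lam * ((1 + e / (lam * b ^+ m + 1)) * b ^+ m))).
  rewrite ler_wpM2l//; apply: (le_trans zm); by rewrite ler_pM2r.
rewrite mulrCA mulrDl mul1r lerD2l mulrAC ler_pdivrMr; last by lra.
by rewrite ler_pM2l//; lra.
Qed.

(** A zonotope between D1 and 2 D1, where D1 = t D has volume 1 and isotropic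
    constant L, has volume at least (2 L)^n and at most 2^n, whence L <= 1. *)
Theorem isotropic_projection_body_shadow_ge (R : realType) (m : nat)
    (D : set 'rV[R]_m.+1) (t : R) (xi : 'rV[R]_m.+1) :
  projection_body D -> 0 < t -> isotropic [set t *: x | x in D] -> sphere xi ->
  6^-1 <= t ^+ m * projection_function D xi.
Proof.
move=> pD t0 [vol1 [L L0 iso]] xi1.
have cD : compact_convex D by case: pD => P _ [[[? ? _] _] _]; split.
have cD1 := compact_convex_scale t cD.
rewrite -projection_function_scale//; apply: (isotropic_shadow_ge cD1 vol1 L0 iso xi1).
have [d d0 hd] := exprD1_small m (ltr01 : 0 < 1 :> R).
have [us [DZ ZD]] := projection_body_zonotope pD d0.
have D1Z : [set t *: x | x in D] `<=` zonotope [seq t *: u | u <- us].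
  by rewrite -zonotopeZ => _ [x Dx <-]; exists x => //; exact: DZ.
have frames := isotropic_zonotope_frames cD1 vol1 L0 iso D1Z.
have := volume_zonotope_ge (ltW L0) frames.
have vD1 : volume [set t *: x | x in D] = 1 by rewrite /volume vol1.
have k0 : 0 < (1 + d) ^+ m by rewrite exprn_gt0//; lra.
have vZ : volume (zonotope [seq t *: u | u <- us]) <= ((1 + d) ^+ m) ^+ m.+1.
  rewrite -[leRHS]mulr1 -[X in _ <= _ * X]vD1 -volume_scale//; last by case: cD1.
  apply: volumeS.
  - by have [] := compact_convex_zonotope [seq t *: u | u <- us].
  - by have [] := compact_convex_scale ((1 + d) ^+ m) cD1.
  rewrite -zonotopeZ scale_comp_image mulrC -scale_comp_image.
  by move=> _ [x Zx <-]; exists x => //; exact: ZD.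
move=> h; have h2 : 2 * L <= (1 + d) ^+ m.
  have k1 := ltW k0; have L2 : 0 <= 2 * L by rewrite mulr_ge0// ltW.
  by rewrite -(@ler_pXn2r _ m.+1)//; exact: le_trans h vZ.
lra.
Qed.

Theorem theorem1 (R : realType) :
  exists2 c : R, 0 < c &
    forall (n : nat) (D K : set 'rV[R]_n), (2 <= n)%N ->
      projection_body D -> dilate_of_isotropic D -> sym_convex_body K ->
      (exists2 xi : 'rV[R]_n, sphere xi &
         projection_function D xi < projection_function K xi) ->
      exists2 M : R,
        is_max [set projection_function K xi - projection_function D xi
               | xi in @sphere R n] M &
        c / (ln (n%:R : R)) ^+ 2 *
          (volume K `^ (n.-1%:R / n%:R) - volume D `^ (n.-1%:R / n%:R)) <= M.
Proof.
have ln20 : 0 < ln (2 : R) by rewrite ln_gt0// ltr1n.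
exists (ln (2 : R) ^+ 2 / 6); first by rewrite divr_gt0// exprn_gt0.
case=> [//|m] D K m2 pD [t t0 iso] sK [xi xi1 DK].
have [rK rK0 subK] := sym_convex_body_cube sK.
have sD : sym_convex_body D by case: pD => L _ [].
have [rD rD0 subD] := sym_convex_body_cube sD.
have cK : compact_convex K by case: sK => -[? ? _] _; split.
have cD : compact_convex D by case: sD => -[? ? _] _; split.
have [M [[xi0 xi01 M0E] Mmax]] := max_projection_difference cK rK0 subK cD rD0 subD.
exists M; first by split => //; exists xi0.
have M0 : 0 < M.
  apply: (@lt_le_trans _ _ (projection_function K xi - projection_function D xi)).
    by rewrite subr_gt0.
  by apply: Mmax; exists xi.
have PK theta : sphere theta ->
    projection_function K theta <= projection_function D theta + M.
  by move=> theta1; rewrite -lerBlDl; apply: Mmax; exists theta.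
have lowD theta := isotropic_projection_body_shadow_ge pD t0 iso (xi := theta).
have tm0 : 0 < t ^+ m by rewrite exprn_gt0.
pose lam := 1 + 6 * t ^+ m * M.
have lam0 : 0 <= lam by rewrite /lam addr_ge0// !mulr_ge0// ltW.
have KD theta : sphere theta ->
    projection_function K theta <= lam * projection_function D theta.
  move=> theta1; apply: (le_trans (PK _ theta1)).
  have := ler_wpM2r (ltW M0) (lowD _ theta1); rewrite /lam; lra.
have [a a0 [Ka ->]] := powR_root m (volume_cube_gt0 cK.1 rK0 subK).
have [b b0 [Db ->]] := powR_root m (volume_cube_gt0 cD.1 rD0 subD).
have ab : a ^+ m <= lam * b ^+ m.
  exact: (shephard_projection_body pD cK rK0 subK a0 b0 lam0 Ka Db KD).
have tb : t * b = 1.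
  have : (t * b) ^+ m.+1 = 1.
    have [vol1 _] := iso.
    by rewrite exprMn -Db -volume_scale//; [rewrite /volume vol1|case: cD].
  by move=> /eqP; rewrite pexpr_eq1 ?mulr_ge0 ?(ltW t0) ?(ltW b0)// => /eqP.
have {}ab : a ^+ m - b ^+ m <= 6 * M.
  have tbm : t ^+ m * b ^+ m = 1 by rewrite -exprMn tb expr1n.
  have E : lam * b ^+ m = b ^+ m + 6 * M * (t ^+ m * b ^+ m) by rewrite /lam; ring.
  by move: ab; rewrite E tbm; lra.
have [d0|d0] := leP (a ^+ m - b ^+ m) 0.
  apply: le_trans (ltW M0); rewrite mulr_ge0_le0// divr_ge0 ?sqr_ge0//.
  by rewrite divr_ge0// sqr_ge0.
have lnn : ln (2 : R) <= ln (m.+1%:R : R) by rewrite ler_ln ?posrE ?ltr0n// ler_nat.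
have lnn0 : 0 < ln (m.+1%:R : R) by exact: lt_le_trans lnn.
have c6 : ln (2 : R) ^+ 2 / 6 / ln (m.+1%:R : R) ^+ 2 <= 6^-1.
  rewrite ler_pdivrMr ?exprn_gt0// [leRHS]mulrC ler_pM2r ?invr_gt0//.
  by rewrite ler_sqr ?nnegrE//; exact: ltW.
by apply: (le_trans (ler_wpM2r (ltW d0) c6)); lra.
Qed.
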